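(* Let $S$ be a semigroup such that the index of every element of order four is either one or two. Then the enhanced power graph $\mathcal{P}_e(S)$ is planar if and only if the following conditions hold: (i) for $a \in S$, we have $o(a) \leq 4$; (ii) $S$ does not contain $a, b, c \in S$ such that $o(a) = o(b) = o(c) = 4$, $m_a = m_b = m_c = 2$ and $|\langle a \rangle \cap \langle b \rangle \cap \langle c \rangle| = 3$.
   Context: For $z \in S$, $\langle z \rangle = \{z^m : m \in \mathbb{N}\}$ (with $\mathbb{N}$ the set of positive integers) is the subsemigroup generated by $z$, and the order of $z$ is $o(z) = |\langle z \rangle|$. For an element $a$ with $\langle a \rangle$ finite, the index $m_a$ of $a$ is the least element of the set $\{x \in \mathbb{N} : a^x = a^y \text{ for some } y \in \mathbb{N}, y \neq x\}$. The enhanced power graph $\mathcal{P}_e(S)$ of a semigroup $S$ is the simple undirected graph with vertex set $S$ in which two distinct vertices $x, y$ are adjacent if and only if $x, y \in \langle z \rangle$ for some $z \in S$. A graph is planar if it can be embedded in the plane, i.e. it can be drawn on the plane in such a way that its edges intersect only at their endpoints.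
   Formalization: For uncountable S, where the claim can fail for lack of room in the plane (e.g. a left-zero band larger than the continuum), planar means that every countable induced subgraph can be drawn in the plane; in (ii) the elements a, b, c are taken pairwise distinct. *)

(* Defs.v *)
From HB Require Import structures.
From mathcomp Require Import all_boot all_order all_algebra.
From mathcomp Require Import all_classical all_reals all_analysis.

Set Implicit Arguments.
Unset Strict Implicit.
Unset Printing Implicit Defensive.

Import numFieldNormedType.Exports.

Local Open Scope classical_set_scope.
Local Open Scope card_scope.

Section MonogenicSubsemigroups.
Variable S : semigroupType.

(* a^n for n > 0; a semigroup has no unit, so the value at n = 0 is junk (a) *)
Definition spow (a : S) (n : nat) : S := iterop n *%g%function a a.

Definition powers (a : S) : set S := [set spow a n | n in [set n | (0 < n)%N]].

Definition has_order (a : S) (n : nat) : Prop := powers a #= `I_n.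

Definition repeating_exponents (a : S) : set nat :=
  [set x | (0 < x)%N /\ exists y, [/\ (0 < y)%N, y <> x & spow a x = spow a y]].

(* A relation rather than a function, as the index exists only when
   powers a is finite. *)
Definition has_index (a : S) (m : nat) : Prop :=
  repeating_exponents a m /\
  forall x, repeating_exponents a x -> (m <= x)%N.

Definition enhanced_power_graph (x y : S) : Prop :=
  x <> y /\ exists z, powers z x /\ powers z y.

Lemma enhanced_power_graph_irrefl (x : S) : ~ enhanced_power_graph x x.
Proof. by case. Qed.

Lemma enhanced_power_graph_sym (x y : S) :
  enhanced_power_graph x y -> enhanced_power_graph y x.
Proof. by move=> [xy [z [zx zy]]]; split; [exact: nesym | exists z]. Qed.

End MonogenicSubsemigroups.

(* A simple graph on the vertex type V is given by its (irreflexive and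
   symmetric) adjacency relation. *)
Section PlaneDrawings.
Variable R : realType.

Definition is_arc (A : set (R * R)) (u v : R * R) : Prop :=
  exists gamma : R -> R * R,
    [/\ {within `[0%R, 1%R], continuous gamma},
        {in `[0%R, 1%R] &, injective gamma},
        gamma 0%R = u, gamma 1%R = v & A = gamma @` `[0%R, 1%R]].

(* p places the vertices and A x y is the curve representing the edge xy.
   The last two clauses say that a curve meets the vertices only at its own
   ends, and another curve only at common ends. *)
Definition is_drawing (V : Type) (adj : V -> V -> Prop)
    (p : V -> R * R) (A : V -> V -> set (R * R)) : Prop :=
  [/\ injective p,
      forall x y, adj x y -> is_arc (A x y) (p x) (p y),
      forall x y, adj x y -> A x y = A y x,
      forall x y v, adj x y -> A x y (p v) -> v = x \/ v = y &
      forall x y z w, adj x y -> adj z w -> [set x; y] <> [set z; w] ->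
        A x y `&` A z w `<=` p @` ([set x; y] `&` [set z; w])].

Definition embeds_in_plane (V : Type) (adj : V -> V -> Prop) : Prop :=
  exists p A, is_drawing adj p A.

Definition induced (V : Type) (adj : V -> V -> Prop) (X : set V)
    (x y : X) : Prop := adj (\val x) (\val y).
Arguments induced {V} adj X.

(* For a countable (in particular a finite) graph this is embeds_in_plane: see
   planar_countable.  An uncountable graph may fail to have a drawing for
   reasons of size only: it can have more vertices than the plane has points,
   and by Moore's theorem on triods uncountably many disjoint copies of K_{1,3}
   cannot be drawn.  Hence, as usual for infinite graphs, such a graph is called
   planar when this holds locally, here for its countable subgraphs. *)
Definition planar (V : Type) (adj : V -> V -> Prop) : Prop :=
  forall X : set V, countable X -> embeds_in_plane (induced adj X).

Lemma embeds_in_plane_inj (V W : Type) (adj : V -> V -> Prop) (f : W -> V) :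
  injective f -> embeds_in_plane adj ->
  embeds_in_plane (fun x y => adj (f x) (f y)).
Proof.
move=> fI [p [A [pI arcA symA endA capA]]].
exists (p \o f), (fun x y => A (f x) (f y)); split => //=.
- exact: inj_comp.
- by move=> x y /arcA.
- by move=> x y /symA.
- by move=> x y v a /(endA _ _ _ a)[] /fI; [left | right].
- move=> x y z w xy zw neq q Aq.
  have f2 u v t : [set f u; f v] (f t) <-> [set u; v] t.
    by split=> -[]; try move/fI; move=> ->; by [left | right].
  have [|x0 [fxyv fzwv] <-] := capA _ _ _ _ xy zw _ q Aq.
    move=> e; apply: neq; apply/seteqP.
    by split=> t /f2; [rewrite e | rewrite -e] => /f2.
  have [t et] : exists t, f t = x0 by case: fxyv => ->; [exists x | exists y].
  by exists t; [split; apply/f2; rewrite et | rewrite /= et].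
Qed.

Lemma planar_countable (V : Type) (adj : V -> V -> Prop) :
  countable [set: V] -> planar adj <-> embeds_in_plane adj.
Proof.
move=> cV; split=> [/(_ _ cV) | emb X _].
  pose f (x : V) : [set: V] := SigSub (mem_set (I : [set: V] x)).
  by apply: (@embeds_in_plane_inj _ _ _ f) => x y /(congr1 \val).
exact: (embeds_in_plane_inj val_inj).
Qed.

End PlaneDrawings.

Arguments embeds_in_plane R {V} adj.
Arguments planar R {V} adj.

(* Main.v *)
Require Import Defs.
From mathcomp Require Import all_boot all_order all_algebra.
From mathcomp Require Import all_classical all_reals all_analysis.
From mathcomp Require Import ring lra zify.
From Stdlib Require Import Btauto.

(* Suppose that K5 or K33 is drawn in the plane.  Approximating its edges by
   polygons with vertices in general position, we may assume that the polygons
   of any two edges without a common end do not cross.  Replacing the polygon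
   of an edge e by a segment changes the parity of its crossings with a polygon
   from y to w by f(y) + f(w), where f counts the triangles swept out from one
   end of e.  In K5 and K33 the edges disjoint from e form a cycle, so these
   changes cancel in the sum over all pairs of disjoint edges.  But this sum is
   odd for a drawing with straight edges.
     The powers of an element of order at least 5 contain a K5, and three
   elements as in (ii) form a K33 with their three common powers.
     Conversely, if all orders are at most 4, then every component of the graph
   contains exactly one idempotent, which is adjacent to all its other vertices.
   Without it the component falls apart into pieces which consist of one vertex
   (the centre) joined to disjoint paths: paths of at most two vertices in
   general, and the path formed by g^2 and at most two elements of index 2, if
   the centre is an element g of order 3 of a group.  All this embeds in the
   graph on fan_vertex, where the leaves of each centre form an infinite path. *)

Set Implicit Arguments.
Unset Strict Implicit.
Unset Printing Implicit Defensive.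
Import Order.TTheory GRing.Theory Num.Theory.
Import numFieldNormedType.Exports.

(** * Parity of crossings in a chirotope *)

Lemma addb_xorb x y : x (+) y = xorb x y. Proof. by case: x. Qed.

Lemma addb_eq (a b x y : bool) : a = b -> x (+) (a (+) b) = y -> x = y.
Proof. by move=> ->; rewrite addbb addbF. Qed.

(* Proves a linear equation over F_2 that is the sum of all equations in the
   context. *)
Ltac sum_of_eqs :=
  repeat match goal with H : @eq bool _ _ |- _ => apply: (addb_eq H); clear H end;
  rewrite ?addb_xorb; btauto.

Lemma uniq_map_nth (T : eqType) (x0 : T) (s : seq T) (m : seq nat) :
  uniq s -> all (fun i => i < size s) m -> uniq m ->
  uniq [seq nth x0 s i | i <- m].
Proof.
move=> us lm um; rewrite map_inj_in_uniq // => i j im jm /eqP.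
by rewrite nth_uniq //; [move/eqP | exact: (allP lm) | exact: (allP lm)].
Qed.

Section Chirotopes.
Variable T : eqType.

(* The orientation of the triples of a planar point set in general position:
   the second axiom holds since det(bcd) - det(acd) + det(abd) - det(abc) = 0,
   the third one by the Grassmann-Pluecker relation
   det(abc)det(ade) - det(abd)det(ace) + det(abe)det(acd) = 0. *)
Definition is_chirotope (o : T -> T -> T -> bool) : Prop :=
  [/\ forall a b c, uniq [:: a; b; c] ->
        o b a c = ~~ o a b c /\ o a c b = ~~ o a b c,
      forall a b c d, uniq [:: a; b; c; d] ->
        ~~ [&& o b c d == o a b d, o a c d == o a b c & o b c d != o a c d] &
      forall a b c d e, uniq [:: a; b; c; d; e] ->
        ~~ [&& (o a b c == o a d e) == (o a b e == o a c d) &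
               (o a b c == o a d e) != (o a b d == o a c e)] ].

Variable o : T -> T -> T -> bool.
Hypothesis oP : is_chirotope o.

Lemma chirotope_perm a b c : uniq [:: a; b; c] ->
  [/\ o b a c = ~~ o a b c, o a c b = ~~ o a b c, o c b a = ~~ o a b c,
      o b c a = o a b c & o c a b = o a b c].
Proof.
case: oP => swap _ _ u; have U m := @uniq_map_nth T a _ m u.
have [e1 e2] := swap _ _ _ u.
have [_ e3] := swap _ _ _ (U [:: 1; 0; 2] isT isT).
have [e4 _] := swap _ _ _ (U [:: 0; 2; 1] isT isT).
have [e5 _] := swap _ _ _ (U [:: 1; 2; 0] isT isT).
by move: e3 e4 e5 => /= e3 e4 e5; split; rewrite ?e5 ?e3 ?e4 ?e1 ?e2 ?negbK.
Qed.

(* [crossing a b c d]: the segments ab and cd cross; [inside a b c d]: the point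
   d lies in the triangle abc. *)
Definition crossing a b c d := (o a b c (+) o a b d) && (o c d a (+) o c d b).

Definition inside a b c d := (o a b d == o b c d) && (o b c d == o c a d).

(* Expresses o by its values on the increasing triples of positions listed in
   ts, then tries all of these values. *)
Ltac check_triples U ts :=
  match ts with
  | nil => clear; repeat match goal with x : bool |- _ => case: x end; by []
  | ?t :: ?ts' =>
    let e1 := fresh in let e2 := fresh in let e3 := fresh in
    let e4 := fresh in let e5 := fresh in
    move: (chirotope_perm (U t isT isT)) => /= [e1 e2 e3 e4 e5];
    rewrite ?{}e2 ?{}e3 ?{}e4 ?{}e5 ?e1;
    match type of e1 with _ = negb ?x => generalize x => ? end;
    check_triples U ts'
  end.

Ltac check_4 U := check_triples U
  [:: [:: 0; 1; 2]; [:: 0; 1; 3]; [:: 0; 2; 3]; [:: 1; 2; 3]].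

Ltac check_5 U := check_triples U
  [:: [:: 0; 1; 2]; [:: 0; 1; 3]; [:: 0; 2; 3]; [:: 1; 2; 3]; [:: 0; 1; 4];
   [:: 0; 2; 4]; [:: 1; 2; 4]; [:: 0; 3; 4]; [:: 1; 3; 4]; [:: 2; 3; 4]].

(** If four points are in convex position, exactly one of their three pairings into segments
    crosses; otherwise exactly one point lies in the triangle of the others. So these seven terms
    sum to 1. *)
Lemma crossing_quadruple a b c d : uniq [:: a; b; c; d] ->
  crossing a b c d (+) crossing a d c b =
  ~~ (crossing a c b d (+) inside a c b d (+) inside a c d b
      (+) (inside b d a c (+) inside b d c a)).
Proof.
move=> u; have U m := @uniq_map_nth T a _ m u.
have [_ /(_ _ _ _ _ u) + _] := oP.
by rewrite /crossing /inside; check_4 U.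
Qed.

Lemma crossing_sym a b c d : crossing c d a b = crossing a b c d.
Proof. by rewrite /crossing andbC. Qed.

Lemma crossing_swap a b c d : uniq [:: a; b; c; d] ->
  crossing b a c d = crossing a b c d.
Proof.
move=> u; have U m := @uniq_map_nth T a _ m u.
by rewrite /crossing; check_4 U.
Qed.

(** Each crossing of [d e] with a side of the triangle [a b c] switches between its inside and its
    outside. *)
Lemma crossing_triangle a b c d e : uniq [:: a; b; c; d; e] ->
  crossing a b d e (+) crossing b c d e (+) crossing c a d e =
  inside a b c d (+) inside a b c e.
Proof.
move=> u; have U m := @uniq_map_nth T a _ m u; have [_ q r] := oP.
move: (q _ _ _ _ (U [:: 0; 1; 2; 3] isT isT)) (q _ _ _ _ (U [:: 0; 1; 2; 4] isT isT))
  (q _ _ _ _ (U [:: 0; 1; 3; 4] isT isT)) (q _ _ _ _ (U [:: 0; 2; 3; 4] isT isT))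
  (q _ _ _ _ (U [:: 1; 2; 3; 4] isT isT)) (r _ _ _ _ _ u)
  (r _ _ _ _ _ (U [:: 1; 0; 2; 3; 4] isT isT)) (r _ _ _ _ _ (U [:: 2; 0; 1; 3; 4] isT isT))
  (r _ _ _ _ _ (U [:: 3; 0; 1; 2; 4] isT isT)) (r _ _ _ _ _ (U [:: 4; 0; 1; 2; 3] isT isT)).
by rewrite /crossing /inside /=; check_5 U.
Qed.

(** The four faces of a tetrahedron projected to the plane cover every point an even number of
    times. *)
Lemma inside_tetrahedron a b c d e : uniq [:: a; b; c; d; e] ->
  inside a b d e (+) inside a c d e (+) inside b c d e = inside a b c e.
Proof.
move=> u; have U m := @uniq_map_nth T a _ m u; have [_ _ r] := oP.
move: (r _ _ _ _ _ (U [:: 4; 0; 1; 2; 3] isT isT)).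
by rewrite /inside /=; check_5 U.
Qed.

(** A straight K5 has 5, 3 or 1 crossings according as its convex hull has 5, 4 or 3 vertices. The
    proof runs through the orientations of all ten triples. *)
Lemma straight_K5 a b c d e : uniq [:: a; b; c; d; e] ->
  \big[addb/false]_(x <- [:: crossing a b c d; crossing a c b d; crossing a d b c;
    crossing a b c e; crossing a c b e; crossing a e b c;
    crossing a b d e; crossing a d b e; crossing a e b d;
    crossing a c d e; crossing a d c e; crossing a e c d;
    crossing b c d e; crossing b d c e; crossing b e c d]) x = true.
Proof.
move=> u; have U m := @uniq_map_nth T a _ m u; have [_ q r] := oP.
move: (q _ _ _ _ (U [:: 0; 1; 2; 3] isT isT)) (q _ _ _ _ (U [:: 0; 1; 2; 4] isT isT))
  (q _ _ _ _ (U [:: 0; 1; 3; 4] isT isT)) (q _ _ _ _ (U [:: 0; 2; 3; 4] isT isT))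
  (q _ _ _ _ (U [:: 1; 2; 3; 4] isT isT)) (r _ _ _ _ _ u)
  (r _ _ _ _ _ (U [:: 1; 0; 2; 3; 4] isT isT)) (r _ _ _ _ _ (U [:: 2; 0; 1; 3; 4] isT isT))
  (r _ _ _ _ _ (U [:: 3; 0; 1; 2; 4] isT isT)) (r _ _ _ _ _ (U [:: 4; 0; 1; 2; 3] isT isT)).
by rewrite unlock /crossing /=; check_5 U.
Qed.

(** The crossings add up to the containments of [d] and [e] in [a b c], and so do the other terms,
    by coning the triangle from [d] and from [e]. *)
Lemma triangle_cone a b c d e : uniq [:: a; b; c; d; e] ->
  (crossing a b d e (+) inside a b d e (+) inside a b e d)
  (+) (crossing a c d e (+) inside a c d e (+) inside a c e d)
  (+) (crossing b c d e (+) inside b c d e (+) inside b c e d) = false.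
Proof.
move=> u; have U m := @uniq_map_nth T a _ m u.
have e1 := crossing_triangle u; have e2 := inside_tetrahedron u.
have /= e3 := inside_tetrahedron (U [:: 0; 1; 2; 4; 3] isT isT).
have /= e4 := crossing_swap (U [:: 0; 2; 3; 4] isT isT).
sum_of_eqs.
Qed.

(** Two vertices from each side give an instance of [crossing_quadruple] with constant term 1, and
    there are nine, an odd number. The remaining terms cancel: the crossings and the triangles on
    two of the [a]s by [triangle_cone], the triangles on two of the [b]s by [inside_tetrahedron],
    which leaves the containment of each [a] in [b0 b1 b2] twice. *)
Lemma straight_K33 a0 a1 a2 b0 b1 b2 : uniq [:: a0; a1; a2; b0; b1; b2] ->
  \big[addb/false]_(x <- [:: crossing a0 b0 a1 b1; crossing a0 b1 a1 b0;
    crossing a0 b0 a1 b2; crossing a0 b2 a1 b0;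
    crossing a0 b1 a1 b2; crossing a0 b2 a1 b1;
    crossing a0 b0 a2 b1; crossing a0 b1 a2 b0;
    crossing a0 b0 a2 b2; crossing a0 b2 a2 b0;
    crossing a0 b1 a2 b2; crossing a0 b2 a2 b1;
    crossing a1 b0 a2 b1; crossing a1 b1 a2 b0;
    crossing a1 b0 a2 b2; crossing a1 b2 a2 b0;
    crossing a1 b1 a2 b2; crossing a1 b2 a2 b1]) x = true.
Proof.
move=> u; have U m := @uniq_map_nth T a0 _ m u.
rewrite unlock /=.
have /= q1 := crossing_quadruple (U [:: 0; 3; 1; 4] isT isT).
have /= q2 := crossing_quadruple (U [:: 0; 3; 1; 5] isT isT).
have /= q3 := crossing_quadruple (U [:: 0; 4; 1; 5] isT isT).
have /= q4 := crossing_quadruple (U [:: 0; 3; 2; 4] isT isT).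
have /= q5 := crossing_quadruple (U [:: 0; 3; 2; 5] isT isT).
have /= q6 := crossing_quadruple (U [:: 0; 4; 2; 5] isT isT).
have /= q7 := crossing_quadruple (U [:: 1; 3; 2; 4] isT isT).
have /= q8 := crossing_quadruple (U [:: 1; 3; 2; 5] isT isT).
have /= q9 := crossing_quadruple (U [:: 1; 4; 2; 5] isT isT).
have /= c1 := triangle_cone (U [:: 0; 1; 2; 3; 4] isT isT).
have /= c2 := triangle_cone (U [:: 0; 1; 2; 3; 5] isT isT).
have /= c3 := triangle_cone (U [:: 0; 1; 2; 4; 5] isT isT).
have /= t1 := inside_tetrahedron (U [:: 3; 4; 5; 0; 1] isT isT).
have /= t2 := inside_tetrahedron (U [:: 3; 4; 5; 0; 2] isT isT).
have /= t3 := inside_tetrahedron (U [:: 3; 4; 5; 1; 2] isT isT).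
have /= t4 := inside_tetrahedron (U [:: 3; 4; 5; 1; 0] isT isT).
have /= t5 := inside_tetrahedron (U [:: 3; 4; 5; 2; 0] isT isT).
have /= t6 := inside_tetrahedron (U [:: 3; 4; 5; 2; 1] isT isT).
sum_of_eqs.
Qed.

(* Number of crossings, modulo 2, of the segment ab with the polygon y :: Q, and
   of the polygons x :: P and y :: Q. *)
Fixpoint seg_crossings a b y Q : bool :=
  if Q is y' :: Q' then crossing a b y y' (+) seg_crossings a b y' Q' else false.

Fixpoint crossings x P y Q : bool :=
  if P is x' :: P' then seg_crossings x x' y Q (+) crossings x' P' y Q else false.

(* Coning the polygon x :: P from v: the parity of the number of triangles of
   the cone that contain z. *)
Fixpoint sweep v x P z : bool :=
  if P is x' :: P' then inside x x' v z (+) sweep v x' P' z else false.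

Lemma crossing_diag a b c : crossing a b c c = false.
Proof. by rewrite /crossing addbb. Qed.

Lemma crossingsC x P y Q : crossings x P y Q = crossings y Q x P.
Proof.
have nilr x' P' y' : crossings x' P' y' [::] = false.
  by elim: P' x' => //= x'' P' IH x'; rewrite IH.
have consr x' P' y' y'' Q' : crossings x' P' y' (y'' :: Q') =
    seg_crossings y' y'' x' P' (+) crossings x' P' y'' Q'.
  elim: P' x' => //= x'' P' IH x'; rewrite {}IH.
  have e := crossing_sym x' x'' y' y''; sum_of_eqs.
elim: Q x P y => [|y' Q IH] x P y; first exact: nilr.
by rewrite consr IH.
Qed.

Lemma seg_crossings_triangle a b c y Q :
  uniq [:: a; b; c] -> {in y :: Q, forall z, z \notin [:: a; b; c]} ->
  seg_crossings a b y Q (+) seg_crossings b c y Q (+) seg_crossings a c y Q =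
  inside a b c y (+) inside a b c (last y Q).
Proof.
move=> u; elim: Q y => [|y' Q IH] y nin /=; first by rewrite addbb.
have /IH e1 : {in y' :: Q, forall z, z \notin [:: a; b; c]}.
  by move=> z zQ; apply: nin; rewrite inE zQ orbT.
suff e2 : crossing a b y y' (+) crossing b c y y' (+) crossing a c y y' =
          inside a b c y (+) inside a b c y' by sum_of_eqs.
have [<-|yy'] := eqVneq y y'; first by rewrite !crossing_diag !addbb.
have u5 : uniq ([:: y; y'] ++ [:: a; b; c]).
  rewrite cat_uniq u andbT; apply/andP; split; first by rewrite /= inE yy'.
  apply/hasPn => z zabc; apply/negP => zy.
  by move: zabc; apply/negP/nin; move: zy; rewrite !inE orbA => ->.
rewrite uniq_catC in u5; have U m := @uniq_map_nth T a _ m u5.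
have /= e1' := crossing_triangle u5.
have /= e2 := crossing_swap (U [:: 0; 2; 3; 4] isT isT).
clear e1; sum_of_eqs.
Qed.

(** The polygon from [x] to [v], closed by the segment [x v], is modulo 2 the sum of the boundaries
    of the triangles of its cone from [v], since each inner side occurs twice. *)
Lemma crossings_cone v x P y Q :
  uniq (x :: rcons P v) -> {in y :: Q, forall z, z \notin x :: rcons P v} ->
  crossings x (rcons P v) y Q (+) seg_crossings x v y Q =
  sweep v x P y (+) sweep v x P (last y Q).
Proof.
elim: P x => [|x' P IH] x; first by rewrite /= addbF addbb.
rewrite rcons_cons => u nin.
have /andP[xP u'] : (x \notin x' :: rcons P v) && uniq (x' :: rcons P v) := u.
have e1 : crossings x' (rcons P v) y Q (+) seg_crossings x' v y Q =
    sweep v x' P y (+) sweep v x' P (last y Q).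
  by apply: IH => // z /nin; rewrite in_cons negb_or => /andP[].
have uvx : uniq [:: x; x'; v].
  apply: subseq_uniq u; rewrite /= !eqxx sub1seq mem_rcons inE eqxx //.
have /= e2 := @seg_crossings_triangle x x' v y Q uvx.
have {}e2 : seg_crossings x x' y Q (+) seg_crossings x' v y Q
   (+) seg_crossings x v y Q = inside x x' v y (+) inside x x' v (last y Q).
  apply: e2 => z /nin; apply: contra; rewrite !inE mem_rcons inE.
  by case/or3P=> ->; rewrite ?orbT.
rewrite /=; clear u nin xP u' uvx; sum_of_eqs.
Qed.

(** First the polygon from [x] to [u] is replaced by a segment, then the polygon from [y] to [w]
    that this segment crosses. *)
Lemma crossings_straighten x P u y Q w :
  uniq ((x :: rcons P u) ++ (y :: rcons Q w)) ->
  crossings x (rcons P u) y (rcons Q w) =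
  crossing x u y w (+) (sweep u x P y (+) sweep u x P w)
                   (+) (sweep w y Q x (+) sweep w y Q u).
Proof.
rewrite cat_uniq => /and3P[uP /hasPn PQ uQ].
have e1 := crossings_cone uP PQ.
have e2 : crossings y (rcons Q w) x [:: u] (+) seg_crossings y w x [:: u] =
          sweep w y Q x (+) sweep w y Q u.
  apply: crossings_cone => // z; rewrite !inE => xu.
  apply/negP => /PQ/negP; apply; rewrite inE mem_rcons inE.
  by case/orP: xu => ->; rewrite ?orbT.
rewrite last_rcons in e1.
rewrite crossingsC /= !addbF (crossing_sym x) in e2.
clear uP PQ uQ; sum_of_eqs.
Qed.

(** * Polygonal drawings of K5 and K33 *)

Lemma K5_crossings (v : 'I_5 -> T) (P : 'I_5 -> 'I_5 -> seq T) :
  injective v ->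
  (forall i j k l : 'I_5, uniq [:: i; j; k; l] ->
     uniq ((v i :: rcons (P i j) (v j)) ++ (v k :: rcons (P k l) (v l)))) ->
  exists i j k l : 'I_5,
    [/\ uniq [:: i; j; k; l], i < j, k < l &
        crossings (v i) (rcons (P i j) (v j)) (v k) (rcons (P k l) (v l))].
Proof.
move=> vI uP; apply: contrapT => noX.
(* With natural numbers as indices, the side conditions of the instances of [H] below hold by
   computation. *)
pose w i := v (inord i); pose S i j := sweep (w j) (w i) (P (inord i) (inord j)).
have H i j k l : all (fun i => i < 5) [:: i; j; k; l] -> uniq [:: i; j; k; l] ->
    i < j -> k < l -> false = crossing (w i) (w j) (w k) (w l)
      (+) (S i j (w k) (+) S i j (w l)) (+) (S k l (w i) (+) S k l (w j)).
  move=> lt_n u ij kl; case/and5P: (lt_n) => ? ? ? ? _.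
  have u' : uniq [:: inord i : 'I_5; inord j; inord k; inord l].
    by rewrite -(map_inj_uniq val_inj) /= !inordK.
  rewrite -crossings_straighten ?uP //; apply/esym/negP => X; apply: noX.
  by exists (inord i), (inord j), (inord k), (inord l); split; rewrite // ?inordK.
have u : uniq [:: w 0; w 1; w 2; w 3; w 4].
  rewrite -[X in uniq X]/(map v [:: inord 0; inord 1; inord 2; inord 3; inord 4]).
  by rewrite map_inj_uniq // -(map_inj_uniq val_inj) /= !inordK.
have := straight_K5 u; rewrite unlock /= => st.
suff : true = false by [].
(* The fifteen pairs of disjoint edges. Each [S i j (w k)] occurs twice in their sum, for the two
   edges at k that are disjoint from ij. *)
have h0 := H 0 1 2 3 isT isT isT isT.
have h1 := H 0 2 1 3 isT isT isT isT.
have h2 := H 0 3 1 2 isT isT isT isT.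
have h3 := H 0 1 2 4 isT isT isT isT.
have h4 := H 0 2 1 4 isT isT isT isT.
have h5 := H 0 4 1 2 isT isT isT isT.
have h6 := H 0 1 3 4 isT isT isT isT.
have h7 := H 0 3 1 4 isT isT isT isT.
have h8 := H 0 4 1 3 isT isT isT isT.
have h9 := H 0 2 3 4 isT isT isT isT.
have h10 := H 0 3 2 4 isT isT isT isT.
have h11 := H 0 4 2 3 isT isT isT isT.
have h12 := H 1 2 3 4 isT isT isT isT.
have h13 := H 1 3 2 4 isT isT isT isT.
have h14 := H 1 4 2 3 isT isT isT isT.
sum_of_eqs.
Qed.

Lemma K33_crossings (v : 'I_6 -> T) (P : 'I_6 -> 'I_6 -> seq T) :
  injective v ->
  (forall i j k l : 'I_6, uniq [:: i; j; k; l] ->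
     uniq ((v i :: rcons (P i j) (v j)) ++ (v k :: rcons (P k l) (v l)))) ->
  exists i j k l : 'I_6,
    [/\ uniq [:: i; j; k; l], i < 3 <= j, k < 3 <= l &
        crossings (v i) (rcons (P i j) (v j)) (v k) (rcons (P k l) (v l))].
Proof.
move=> vI uP; apply: contrapT => noX.
pose w i := v (inord i); pose S i j := sweep (w j) (w i) (P (inord i) (inord j)).
have H i j k l : all (fun i => i < 6) [:: i; j; k; l] -> uniq [:: i; j; k; l] ->
    i < 3 <= j -> k < 3 <= l -> false = crossing (w i) (w j) (w k) (w l)
      (+) (S i j (w k) (+) S i j (w l)) (+) (S k l (w i) (+) S k l (w j)).
  move=> lt_n u ij kl; case/and5P: (lt_n) => ? ? ? ? _.
  have u' : uniq [:: inord i : 'I_6; inord j; inord k; inord l].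
    by rewrite -(map_inj_uniq val_inj) /= !inordK.
  rewrite -crossings_straighten ?uP //; apply/esym/negP => X; apply: noX.
  by exists (inord i), (inord j), (inord k), (inord l); split; rewrite // ?inordK.
have u : uniq [:: w 0; w 1; w 2; w 3; w 4; w 5].
  rewrite -[X in uniq X]/(map v [:: inord 0; inord 1; inord 2; inord 3; inord 4; inord 5]).
  by rewrite map_inj_uniq // -(map_inj_uniq val_inj) /= !inordK.
have := straight_K33 u; rewrite unlock /= => st.
suff : true = false by [].
(* The eighteen pairs of disjoint edges; again a vertex off an edge lies on exactly two edges
   disjoint from it. *)
have h0 := H 0 3 1 4 isT isT isT isT.
have h1 := H 0 4 1 3 isT isT isT isT.
have h2 := H 0 3 1 5 isT isT isT isT.
have h3 := H 0 5 1 3 isT isT isT isT.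
have h4 := H 0 4 1 5 isT isT isT isT.
have h5 := H 0 5 1 4 isT isT isT isT.
have h6 := H 0 3 2 4 isT isT isT isT.
have h7 := H 0 4 2 3 isT isT isT isT.
have h8 := H 0 3 2 5 isT isT isT isT.
have h9 := H 0 5 2 3 isT isT isT isT.
have h10 := H 0 4 2 5 isT isT isT isT.
have h11 := H 0 5 2 4 isT isT isT isT.
have h12 := H 1 3 2 4 isT isT isT isT.
have h13 := H 1 4 2 3 isT isT isT isT.
have h14 := H 1 3 2 5 isT isT isT isT.
have h15 := H 1 5 2 3 isT isT isT isT.
have h16 := H 1 4 2 5 isT isT isT isT.
have h17 := H 1 5 2 4 isT isT isT isT.
sum_of_eqs.
Qed.

End Chirotopes.

(** * Points in general position *)

Section GeneralPosition.
Variable R : realFieldType.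
Implicit Types a b c d : R * R.
Local Open Scope ring_scope.

(** Twice the signed area of the triangle [a b c]. *)
Definition det3 a b c : R :=
  (b.1 - a.1) * (c.2 - a.2) - (b.2 - a.2) * (c.1 - a.1).

Definition general_position (T : eqType) (q : T -> R * R) (s : seq T) : Prop :=
  forall i j k, i \in s -> j \in s -> k \in s -> uniq [:: i; j; k] ->
    det3 (q i) (q j) (q k) != 0.

Definition orientation (T : eqType) (q : T -> R * R) i j k : bool :=
  0 < det3 (q i) (q j) (q k).

Lemma orientation_chirotope (T : finType) (q : T -> R * R) :
  general_position q (enum T) -> is_chirotope (orientation q).
Proof.
move=> gp.
have {}gp i j k : uniq [:: i; j; k] -> det3 (q i) (q j) (q k) != 0.
  by apply: gp; rewrite mem_enum.
have posM (x y : R) : x != 0 -> y != 0 -> ((0 < x) == (0 < y)) = (0 < x * y).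
  move=> /lt_total/orP[] x0 /lt_total/orP[] y0;
    rewrite ?x0 ?y0 ?(lt_gtF x0) ?(lt_gtF y0) /=.
  - by rewrite nmulr_rgt0.
  - by rewrite nmulr_rgt0 // (lt_gtF y0).
  - by rewrite pmulr_rgt0 // (lt_gtF y0).
  - by rewrite pmulr_rgt0.
split=> [a b c u|a b c d u|a b c d e u]; have U m := @uniq_map_nth _ a _ m u;
  rewrite /orientation.
- have := gp _ _ _ u.
  have -> : det3 (q b) (q a) (q c) = - det3 (q a) (q b) (q c) by rewrite /det3; ring.
  have -> : det3 (q a) (q c) (q b) = - det3 (q a) (q b) (q c) by rewrite /det3; ring.
  by case/lt_total/orP => x0; rewrite oppr_gt0 x0 (lt_gtF x0).
- have := gp _ _ _ (U [:: 0; 1; 2]%N isT isT).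
  have := gp _ _ _ (U [:: 0; 1; 3]%N isT isT).
  have := gp _ _ _ (U [:: 0; 2; 3]%N isT isT).
  have := gp _ _ _ (U [:: 1; 2; 3]%N isT isT) => /=.
  (* In the forbidden sign pattern all terms of this vanishing sum would have the same sign;
     likewise for the products below. *)
  have : det3 (q b) (q c) (q d) - det3 (q a) (q c) (q d)
     + det3 (q a) (q b) (q d) - det3 (q a) (q b) (q c) = 0 by rewrite /det3; ring.
  move: (det3 _ _ _) (det3 _ _ _) (det3 _ _ _) (det3 _ _ _) => x y z t e.
  do 4! [case/lt_total/orP => ?];
  repeat match goal with H : is_true (?u < ?v) |- _ =>
    rewrite ?H ?(lt_gtF H); move: H end => //=; lra.
- have /= abc := gp _ _ _ (U [:: 0; 1; 2]%N isT isT).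
  have /= abd := gp _ _ _ (U [:: 0; 1; 3]%N isT isT).
  have /= abe := gp _ _ _ (U [:: 0; 1; 4]%N isT isT).
  have /= acd := gp _ _ _ (U [:: 0; 2; 3]%N isT isT).
  have /= ace := gp _ _ _ (U [:: 0; 2; 4]%N isT isT).
  have /= ade := gp _ _ _ (U [:: 0; 3; 4]%N isT isT).
  rewrite (posM _ _ abc ade) (posM _ _ abd ace) (posM _ _ abe acd).
  have := mulf_neq0 abc ade; have := mulf_neq0 abd ace; have := mulf_neq0 abe acd.
  have : det3 (q a) (q b) (q c) * det3 (q a) (q d) (q e)
     - det3 (q a) (q b) (q d) * det3 (q a) (q c) (q e)
     + det3 (q a) (q b) (q e) * det3 (q a) (q c) (q d) = 0 by rewrite /det3; ring.
  move: (det3 _ _ _ * _) (det3 _ _ _ * _) (det3 _ _ _ * _) => /= x y z e0.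
  do 3! [case/lt_total/orP => ?];
  repeat match goal with H : is_true (?u < ?v) |- _ =>
    rewrite ?H ?(lt_gtF H); move: H end => //=; lra.
Qed.

Definition segment_point (t : R) a b : R * R :=
  (a.1 + t * (b.1 - a.1), a.2 + t * (b.2 - a.2)).

Lemma crossing_common_point (T : eqType) (q : T -> R * R) (i j k l : T) :
  crossing (orientation q) i j k l ->
  exists s t : R, [/\ 0 <= s <= 1, 0 <= t <= 1 &
    segment_point s (q i) (q j) = segment_point t (q k) (q l)].
Proof.
rewrite /crossing /orientation => /andP[].
have opp (x y : R) : (0 < x) (+) (0 < y) -> x - y != 0 /\ 0 <= x / (x - y) <= 1.
  case: (ltP 0 x) => x0; case: (ltP 0 y) => y0 //= _.
    have xy : 0 < x - y by lra.
    rewrite gt_eqF // divr_ge0 ?(ltW x0) ?(ltW xy) //= ler_pdivrMr // mul1r.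
    by split=> //; lra.
  have xy : 0 < y - x by lra.
  rewrite -oppr_eq0 opprB gt_eqF // -(opprB y) invrN mulrN -mulNr.
  rewrite divr_ge0 ?oppr_ge0 ?(ltW xy) //= ler_pdivrMr // mul1r.
  by split=> //; lra.
move=> /opp[x0 x1] /opp[y0 y1].
(* On each segment, the zero of the affine function [det3] that defines the line through the other
   segment. *)
exists (det3 (q k) (q l) (q i) / (det3 (q k) (q l) (q i) - det3 (q k) (q l) (q j))).
exists (det3 (q i) (q j) (q k) / (det3 (q i) (q j) (q k) - det3 (q i) (q j) (q l))).
split=> //; rewrite /segment_point; move: x0 y0; rewrite /det3 => x0 y0.
by congr pair; field; apply/andP.
Qed.

Lemma small_nonroot (F : {poly R}) (e : R) : F != 0 -> 0 < e ->
  exists t, 0 < t < e /\ F.[t] != 0.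
Proof.
move=> F0 e0; apply: contrapT => no.
(* One point more than the degree of [F] allows as roots; [k.+2] keeps them all below [e]. *)
pose rs := [seq e / k.+2%:R | k <- iota 0 (size F)].
suff : (size rs < size F)%N by rewrite size_map size_iota ltnn.
apply: max_poly_roots => //.
  apply/allP => _ /mapP[k _ ->]; apply/negPn/negP => nr; apply: no.
  exists (e / k.+2%:R); split=> //; rewrite divr_gt0 // ltr_pdivrMr //.
  by rewrite -[X in X < _]mulr1 ltr_pM2l // ltr1n.
rewrite map_inj_uniq ?iota_uniq // => k l /(mulfI (lt0r_neq0 e0))/invr_inj/eqP.
by rewrite eqr_nat eqSS eqSS => /eqP.
Qed.

Lemma det3_rot a b c : det3 b c a = det3 a b c.
Proof. by rewrite /det3; ring. Qed.

Lemma general_position_near (T : finType) (q0 : T -> R * R) (e : R) : 0 < e ->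
  exists q, general_position q (enum T) /\
    forall i, `|(q i).1 - (q0 i).1| < e /\ `|(q i).2 - (q0 i).2| < e.
Proof.
(* Injectivity is carried along because general position does not separate the points of a set of
   fewer than three, and the induction needs the line through any two of them. *)
move=> e0; suff : exists q, [/\ general_position q (enum T),
    {in enum T &, injective q} &
    forall i, `|(q i).1 - (q0 i).1| < e /\ `|(q i).2 - (q0 i).2| < e].
  by move=> [q [? _ ?]]; exists q.
elim: (enum T) => [|i s [q [gp qI close]]].
  by exists q0; split=> [? ? ?|? ?|?] //; rewrite !subrr !normr0.
have [si|si] := boolP (i \in s).
  have sub : {subset i :: s <= s} by move=> j; rewrite inE => /predU1P[->|].
  exists q; split=> //; first by move=> j k l /sub js /sub ks /sub ls; exact: gp.
  by move=> j k /sub js /sub ks; exact: qI.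
(* Every line meets the parabola t |-> q0 i + (t, t^2) in at most two points. *)
pose line a b : {poly R} := (b.1 - a.1)%:P * ('X^2 + ((q0 i).2 - a.2)%:P)
  - (b.2 - a.2)%:P * ('X + ((q0 i).1 - a.1)%:P).
(* The first product keeps the new point distinct from the old ones, the second keeps it off the
   lines through them. *)
pose F := \prod_(j <- s) ('X + ((q0 i).1 - (q j).1)%:P) *
  \prod_(j <- s) \prod_(k <- s | q j != q k) line (q j) (q k).
have F0 : F != 0.
  rewrite mulf_neq0 // prodf_seq_neq0; apply/allP => j _ /=.
    by rewrite -size_poly_gt0 size_XaddC.
  rewrite prodf_seq_neq0; apply/allP => k _ /=; apply/implyP.
  apply: contraNneq => l0.
  have : (line (q j) (q k))`_2 = 0 by rewrite l0 coef0.
  have : (line (q j) (q k))`_1 = 0 by rewrite l0 coef0.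
  rewrite /line !(coefB, coefCM, coefD, coefXn, coefX, coefC) /=.
  case: (q j) (q k) => x y [x' y'] /= /eqP e1 /eqP e2.
  by apply/eqP; congr pair; lra.
(* The bound 1 gives [t ^+ 2 < t < e], so that the second coordinate is close as well. *)
have [|t [/andP[t0 te] nr]] := small_nonroot F0 (e := Num.min e 1).
  by rewrite lt_min e0 ltr01.
move: te; rewrite lt_min => /andP[te t1].
pose p := ((q0 i).1 + t, (q0 i).2 + t ^+ 2).
have pq j : j \in s -> p <> q j.
  move=> js pj; move: nr; rewrite hornerM mulf_eq0 negb_or => /andP[+ _].
  rewrite horner_prod prodf_seq_neq0 => /allP/(_ _ js) /=.
  by rewrite hornerD hornerX hornerC -pj /= => /eqP; apply; ring.
have pl j k : j \in s -> k \in s -> j != k -> det3 (q j) (q k) p != 0.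
  move=> js ks jk; move: nr; rewrite hornerM mulf_eq0 negb_or => /andP[_].
  rewrite horner_prod prodf_seq_neq0 => /allP/(_ _ js) /=.
  rewrite horner_prod prodf_seq_neq0 => /allP/(_ _ ks) /=.
  have -> : q j != q k by apply: contra jk => /eqP/qI ->.
  rewrite /line !hornerE /det3 /=; congr (_ != 0).
  by ring.
have neq_i j : j \in s -> (j == i) = false.
  by move=> js; apply: contraNF si => /eqP <-.
exists (fun j => if j == i then p else q j); split.
- move=> j k l; rewrite !inE => /predU1P js /predU1P ks /predU1P ls u.
  move: u js ks ls; rewrite /= !inE negb_or andbT => /andP[/andP[jk jl] kl].
  case=> [ji|js]; case=> [ki|ks]; case=> [li|ls];
    rewrite ?ji ?ki ?li ?eqxx ?(neq_i _ js) ?(neq_i _ ks) ?(neq_i _ ls);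
    try by move: jk jl kl; rewrite ?ji ?ki ?li eqxx.
  + by rewrite -det3_rot pl.
  + by rewrite det3_rot pl // eq_sym.
  + by rewrite pl.
  + by apply: gp => //; rewrite /= !inE negb_or jk jl kl.
- move=> j k; rewrite !inE => /predU1P js /predU1P ks.
  case: js ks => [->|js] [->|ks] //; rewrite ?eqxx ?neq_i //.
  + by move/pq => /(_ ks).
  + by move/esym/pq => /(_ js).
  + by move/qI; exact.
- move=> j; case: eqP => [->|_] //=.
  rewrite [_ + t]addrC [_ + t ^+ 2]addrC !addrK !ger0_norm ?exprn_ge0 ?(ltW t0) //.
  by rewrite expr2; split=> //; nra.
Qed.

End GeneralPosition.

(** * Topological drawings of K5 and K33 *)

Section Approximation.
Variable R : realType.
Local Open Scope classical_set_scope.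
Local Open Scope ring_scope.

(** Each point of [A] has a ball that misses the closed set [B]. Half its radius serves for all
    points of the ball of half the radius, and compactness makes the choice uniform. *)
Lemma disjoint_compact_apart (A B : set (R * R)) :
  compact A -> compact B -> A `&` B = set0 ->
  \forall e \near 0^'+, forall x y, A x -> B y -> ~ ball x e y.
Proof.
move=> cA cB AB0.
have oB : open (~` B) by apply: closed_openC; apply: compact_closed => //; exact: norm_hausdorff.
move/compact_near_coveringP : cA.
move=> /(_ R 0^'+ (fun e x => forall y, B y -> ~ ball x e y)) cov.
have : \forall e \near 0^'+, A `<=` (fun x => forall y, B y -> ~ ball x e y).
  apply: cov => x Ax.
  have /nbhs_ballP[d /= d0 dB] : nbhs x (~` B).
    by apply: open_nbhs_nbhs; split=> // Bx; have : (A `&` B) x by []; rewrite AB0.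
  have d20 : 0 < d / 2 by rewrite divr_gt0.
  exists (ball x (d / 2), [set e | e < d / 2]) => /=.
    by split; [exact: nbhsx_ballx | exact: nbhs_right_lt].
  move=> [x' e] /= [xx' ed] y By x'y; apply: (dB y) => //.
  rewrite [d]splitr; apply: ball_triangle xx' _.
  by apply: le_ball x'y; exact: ltW.
by apply: filterS => e H x y Ax; exact: H.
Qed.

(** Uniform continuity on a compact interval, in the form needed to cut it into [n.+1] equal
    parts. *)
Lemma arc_mesh (g : R -> R * R) (e : R) :
  {within `[0, 1], continuous g} -> 0 < e ->
  \forall n \near \oo, forall s t, `[0, 1]%classic s -> `[0, 1]%classic t ->
    `|s - t| <= n.+1%:R^-1 -> ball (g s) e (g t).
Proof.
move=> /subspace_continuousP cg e0.
have := @segment_compact R 0 1 => /compact_near_coveringP.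
move=> /(_ nat \oo (fun n s => `[0, 1]%classic s -> forall t, `[0, 1]%classic t ->
    `|s - t| <= n.+1%:R^-1 -> ball (g s) e (g t))) cov.
suff : \forall n \near \oo, `[0, 1] `<=` (fun s : R => `[0, 1]%classic s ->
    forall t, `[0, 1]%classic t -> `|s - t| <= n.+1%:R^-1 -> ball (g s) e (g t)).
  by apply: filterS => n H s t s01; exact: (H s).
apply: cov => x x01.
have e20 : 0 < e / 2 by rewrite divr_gt0.
have : nbhs (g x) (ball (g x) (e / 2)) by exact: nbhsx_ballx.
move=> /(cg x x01) /nbhs_ballP[d /= d0 dg].
have d20 : 0 < d / 2 by rewrite divr_gt0.
exists (ball x (d / 2), [set n | n.+1%:R^-1 < d / 2]) => /=.
  by split; [exact: nbhsx_ballx | exact: (near_infty_natSinv_lt (PosNum d20))].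
move=> [s n] /= [xs nd] s01 t t01 st.
have st' : ball s (d / 2) t by rewrite /ball /=; exact: le_lt_trans nd.
have xt : ball x d t by rewrite [d]splitr; exact: ball_triangle xs st'.
have xs' : ball x d s by apply: le_ball xs; rewrite ler_pdivrMr // ler_peMr // ?ler1n // ltW.
rewrite [e]splitr; apply: ball_triangle (dg t xt t01).
by apply: ball_sym; exact: dg.
Qed.

Lemma segment_point_ball (g a b : R * R) (e s : R) :
  0 <= s <= 1 -> ball g e a -> ball g e b -> ball g e (segment_point s a b).
Proof.
case: g a b => g1 g2 [a1 a2] [b1 b2] /andP[s0 s1].
have H (x y z : R) : `|x - y| < e -> `|x - z| < e -> `|x - (y + s * (z - y))| < e.
  move=> xy xz; have : Num.max `|x - y| `|x - z| < e by rewrite gt_max xy.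
  have : `|x - y| <= Num.max `|x - y| `|x - z| by rewrite le_max lexx.
  have : `|x - z| <= Num.max `|x - y| `|x - z| by rewrite le_max lexx orbT.
  move: (Num.max _ _) => m; rewrite !ler_norml ltr_norml.
  by move=> /andP[? ?] /andP[? ?] ?; apply/andP; split; nra.
by move=> [/= ? ?] [/= ? ?]; split; exact: H.
Qed.

Section CloseTo.
Variables (T : eqType) (q : T -> R * R) (e : R).

(** Both ends are near one and the same point of [A]; as balls are convex, so is the whole segment
    between them. *)
Definition close_to (A : set (R * R)) : rel T :=
  fun a b => `[< exists2 g, A g & ball g e (q a) /\ ball g e (q b) >].

Lemma crossings_apart (A B : set (R * R)) x P y Q :
  (forall g h, A g -> B h -> ~ ball g (e + e) h) ->
  path (close_to A) x P -> path (close_to B) y Q ->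
  crossings (orientation q) x P y Q = false.
Proof.
move=> apart.
have seg a b y' Q' : close_to A a b -> path (close_to B) y' Q' ->
    seg_crossings (orientation q) a b y' Q' = false.
  move=> Aab; elim: Q' y' => //= y'' Q' IH y' /andP[/asboolP[h Bh [hy hy']] /IH ->].
  rewrite addbF; apply/negP => /crossing_common_point[s [t [s01 t01 E]]].
  move/asboolP: Aab => [g Ag [ga gb]]; apply: (apart g h) => //.
  apply: (@ball_triangle _ _ (segment_point s (q a) (q b))).
    exact: segment_point_ball.
  by apply: ball_sym; rewrite E; exact: segment_point_ball.
elim: P x => //= x' P IH x /andP[Axx' P'] Q'.
by rewrite IH // seg.
Qed.

End CloseTo.

Lemma path_rcons_iota (T : Type) (r : rel T) (f : nat -> T) x y m n :
  r x (f m) -> r (f (m + n)%N) y ->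
  (forall k, (m <= k < m + n)%N -> r (f k) (f k.+1)) ->
  path r x (rcons [seq f k | k <- iota m n.+1] y).
Proof.
elim: n x m => [|n IH] x m; first by rewrite addn0 /= => -> ->.
move=> xm ny step; rewrite /= xm /=; apply: IH.
- by apply: step; rewrite leqnn addnS ltnS leq_addr.
- by rewrite addSnnS.
- by move=> k /andP[mk kn]; apply: step; rewrite ltnW // -addSnnS.
Qed.

Lemma drawing_polygons (V : finType) (adj : V -> V -> Prop) :
  embeds_in_plane R adj ->
  exists (T : finType) (o : T -> T -> T -> bool) (v : V -> T) (P : V -> V -> seq T),
  [/\ is_chirotope o, injective v,
      forall i j k l, uniq [:: i; j; k; l] ->
        uniq ((v i :: rcons (P i j) (v j)) ++ (v k :: rcons (P k l) (v l))) &
      forall i j k l, uniq [:: i; j; k; l] -> adj i j -> adj k l ->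
        crossings o (v i) (rcons (P i j) (v j)) (v k) (rcons (P k l) (v l)) = false].
Proof.
move=> [p [A [pI arcA symA endA capA]]].
have /choice[gam gamP] : forall ij : V * V, exists g : R -> R * R, adj ij.1 ij.2 ->
    [/\ {within `[0, 1], continuous g}, g 0 = p ij.1, g 1 = p ij.2 &
        A ij.1 ij.2 = g @` `[0, 1]].
  move=> [i j].
  have [ij|?] := pselect (adj i j); last by exists (fun=> 0).
  by have [g [? ? ? ? ?]] := arcA _ _ ij; exists g.
have cA i j : adj i j -> compact (A i j).
  move=> ij; have [cg _ _ ->] := gamP (i, j) ij.
  by apply: continuous_compact => //; exact: segment_compact.
pose indep (x : V * V * (V * V)) := [/\ uniq [:: x.1.1; x.1.2; x.2.1; x.2.2],
  adj x.1.1 x.1.2 & adj x.2.1 x.2.2].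
have : \forall e \near (0 : R)^'+, forall x, indep x ->
    forall g h, A x.1.1 x.1.2 g -> A x.2.1 x.2.2 h -> ~ ball g e h.
  apply: filter_forall => -[[i j] [k l]] /=.
  have [[/= u ij kl]|no] := pselect (indep (i, j, (k, l))); last first.
    by apply: nearW => e; move/no.
  have : \forall e \near (0 : R)^'+, forall g h, A i j g -> A k l h -> ~ ball g e h.
    apply: disjoint_compact_apart; [exact: cA | exact: cA |].
    rewrite -subset0 => z Az.
    have neq : [set i; j] <> [set k; l].
      move=> e; have : [set k; l] i by rewrite -e; left.
      by case=> E; move: u; rewrite E /= !inE eqxx ?orbT.
    have [w [ijw klw] _] := capA _ _ _ _ ij kl neq z Az.
    by case: ijw u klw => -> u [] E; move: u; rewrite E /= !inE eqxx ?orbT ?andbF.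
  by apply: filterS => e H _; exact: H.
move=> eP.
(* The points of a polygon will be within [e + e] of the arc, [e] for the mesh and [e] for the
   perturbation. Two arcs together need four times [e]. *)
have [e [e0 apart]] : exists e : R, 0 < e /\ forall x, indep x ->
    forall g h, A x.1.1 x.1.2 g -> A x.2.1 x.2.2 h -> ~ ball g ((e + e) + (e + e)) h.
  have : \forall e \near (0:R)^'+, 0 < e by exact: nbhs_right_gt.
  move/(filterI eP) => /filter_ex[e [eP' e0]]; exists (e / 4); split; first by rewrite divr_gt0.
  by move=> x /eP'; have -> : e / 4 + e / 4 + (e / 4 + e / 4) = e by lra.
have : \forall n \near \oo, forall ij, adj ij.1 ij.2 ->
    forall s t, `[0, 1]%classic s -> `[0, 1]%classic t ->
    `|s - t| <= n.+1%:R^-1 -> ball (gam ij s) e (gam ij t).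
  apply: filter_forall => ij; have [aij|no] := pselect (adj ij.1 ij.2); last first.
    by apply: nearW => n /no.
  have [cg _ _ _] := gamP ij aij.
  by apply: filterS (arc_mesh cg e0) => n H _; exact: H.
move=> /filter_ex[n mesh].
(* The parameters [k / (n + 1)] include 0 and 1, so [q0] takes the same value at the end of an arc
   and at its vertex; [general_position_near] pulls these points apart. *)
pose T : finType := (V + V * V * 'I_n.+2)%type.
pose q0 (t : T) := match t with inl i => p i | inr (ij, k) => gam ij (k%:R / n.+1%:R) end.
have [q [gp qq0]] := general_position_near q0 e0.
pose P i j : seq T := [seq inr (i, j, inord k) | k <- iota 0 n.+2].
exists T, (orientation q), inl, P; split.
- exact: orientation_chirotope.
- by move=> i j [].
- move=> i j k l u; pose t : seq T := map inl [:: i; j; k; l].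
  rewrite (@perm_uniq _ _ (t ++ (P i j ++ P k l))); last first.
    apply/permP => a; rewrite /t /= !count_cat /= -!cats1 !count_cat /=; lia.
  have uP i' j' : uniq (P i' j').
    rewrite map_inj_in_uniq ?iota_uniq // => x y.
    rewrite !mem_iota !add0n => /andP[_ xn] /andP[_ yn] [] /(congr1 val).
    by rewrite /= !inordK.
  rewrite cat_uniq (map_inj_uniq inl_inj) u cat_uniq !uP andbT !andTb.
  apply/andP; split.
    by apply/hasPn => x; rewrite mem_cat => /orP[] /mapP[y _ ->].
  apply/hasPn => _ /mapP[x _ ->]; apply/negP => /mapP[y _ [ki _ _]].
  by move: u; rewrite ki /= !inE eqxx !orbT.
have near_q t : ball (q0 t) e (q t).
  by have [? ?] := qq0 t; split; rewrite /ball /= distrC.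
have close i j : adj i j -> path (close_to q (e + e) (A i j)) (inl i) (rcons (P i j) (inl j)).
  move=> ij; have [cg g0 g1 Aij] := gamP (i, j) ij.
  have e2 : e <= e + e by rewrite lerDl ltW.
  have ok t : t \in `[0, 1]%R -> A i j (gam (i, j) t) by move=> t01; rewrite Aij; exists t.
  apply: path_rcons_iota.
  + apply/asboolP; exists (p i); first by rewrite -g0; apply: ok; rewrite in_itv /= lexx ler01.
    split; first by apply: le_ball e2 _ (near_q (inl i)).
    apply: le_ball e2 _ _; have := near_q (inr (i, j, inord 0)).
    by rewrite /= inordK // mul0r g0.
  + apply/asboolP; exists (p j); first by rewrite -g1; apply: ok; rewrite in_itv /= lexx ler01.
    split; last by apply: le_ball e2 _ (near_q (inl j)).
    apply: le_ball e2 _ _; have := near_q (inr (i, j, inord (0 + n.+1))).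
    by rewrite /= inordK // divff ?g1 // pnatr_eq0.
  + move=> k /andP[_ kn].
    have k01 m : (m <= n.+1)%N -> m%:R / n.+1%:R \in `[0, 1 : R]%R.
      move=> mn; rewrite in_itv /= divr_ge0 ?ler0n //= ler_pdivrMr ?ltr0n //.
      by rewrite mul1r ler_nat.
    apply/asboolP; exists (gam (i, j) (k%:R / n.+1%:R)); first by apply/ok/k01/ltnW.
    have := near_q (inr (i, j, inord k)); have := near_q (inr (i, j, inord k.+1)).
    rewrite /= !inordK //; last exact: ltnW.
    move=> q1 q2; split; first exact: le_ball e2 _ q2.
    apply: ball_triangle q1; apply: mesh => //; [exact/k01/ltnW | exact: k01 |].
    by rewrite distrC -mulrBl -natrB // subSnn mul1r ger0_norm // invr_ge0 ler0n.
move=> i j k l u ij kl.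
apply: (@crossings_apart _ _ (e + e) (A i j) (A k l)); [|exact: close|exact: close].
by apply: (apart (i, j, (k, l))).
Qed.

Lemma K5_not_plane : ~ embeds_in_plane R (fun i j : 'I_5 => i != j).
Proof.
move=> /drawing_polygons[T [ch [v [P [oP vI uP nX]]]]].
have [i [j [k [l [u ij kl X]]]]] := K5_crossings oP vI uP.
by move: X; rewrite nX //; apply/eqP => e; [move: ij | move: kl]; rewrite e ltnn.
Qed.

Lemma K33_not_plane :
  ~ embeds_in_plane R (fun i j : 'I_6 => (i < 3)%N (+) (j < 3)%N).
Proof.
move=> /drawing_polygons[T [ch [v [P [oP vI uP nX]]]]].
have [i [j [k [l [u /andP[i3 j3] /andP[k3 l3] X]]]]] := K33_crossings oP vI uP.
by move: X; rewrite nX // ?i3 ?k3 ltnNge ?j3 ?l3.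
Qed.

End Approximation.

(** * A straight drawing of the fan graph *)

(** All indices range over [nat], so that codes of semigroup elements can serve as indices. *)
Inductive fan_vertex : Type :=
  | Apex of nat
  | Centre of nat & nat
  | Leaf of nat & nat & nat.

Definition fan_edge (u v : fan_vertex) : Prop :=
  match u, v with
  | Apex i, Centre i' _ => i = i'
  | Apex i, Leaf i' _ _ => i = i'
  | Centre i j, Leaf i' j' _ => i = i' /\ j = j'
  | Leaf i j n, Leaf i' j' n' => [/\ i = i', j = j' & n' = n.+1]
  | _, _ => False
  end.

Definition fan_adj (u v : fan_vertex) : Prop := fan_edge u v \/ fan_edge v u.

Section Drawing.
Variable R : realType.
Local Open Scope classical_set_scope.
Local Open Scope ring_scope.

Lemma embeds_in_plane_sub (V : Type) (adj adj' : V -> V -> Prop) :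
  (forall x y, adj' x y -> adj x y) ->
  embeds_in_plane R adj -> embeds_in_plane R adj'.
Proof.
move=> sub [p [A [pI arcA symA endA capA]]]; exists p, A; split => //.
- by move=> x y /sub; exact: arcA.
- by move=> x y /sub; exact: symA.
- by move=> x y v /sub; exact: endA.
- by move=> x y z w /sub xy /sub zw; exact: capA.
Qed.

Definition segment (a b : R * R) : set (R * R) :=
  [set segment_point t a b | t in `[0, 1]].

Lemma segment_arc (a b : R * R) : a <> b -> is_arc (segment a b) a b.
Proof.
move=> ab; exists (fun t => segment_point t a b); split => //.
- have affine (c d : R) : continuous (fun t : R => c + t * d).
    by move=> t; apply: cvgD; [exact: cvg_cst | apply: cvgM; [exact: cvg_id | exact: cvg_cst]].
  apply: continuous_subspaceT => t.
  exact: (cvg_pair (affine a.1 (b.1 - a.1) t) (affine a.2 (b.2 - a.2) t)).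
- move=> s t _ _ []; case: a b ab => a1 a2 [b1 b2] ab /= /addrI e1 /addrI e2.
  apply/eqP/negPn/negP => st; apply: ab.
  by congr pair; apply/eqP; rewrite eq_sym -subr_eq0; apply/eqP;
    [move: e1 | move: e2] => /eqP; rewrite -subr_eq0 -mulrBl mulf_eq0 subr_eq0 (negPf st) => /eqP.
- by case: a {ab} => a1 a2; rewrite /segment_point !mul0r !addr0.
- by case: b {ab} => b1 b2; rewrite /segment_point !mul1r !(addrC _ (_ - _)) !subrK.
Qed.

Lemma segmentC (a b : R * R) : segment a b = segment b a.
Proof.
have sub c d : segment c d `<=` segment d c.
  move=> _ [t + <-]; rewrite set_itvcc => /andP[t0 t1].
  exists (1 - t); first by rewrite set_itvcc /=; lra.
  by rewrite /segment_point; congr pair; ring.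
by apply/seteqP; split; exact: sub.
Qed.

(** The offset 3 keeps the heights below 1/2, where the triangle of [j] would meet the next one. The
    heights decrease to 0, which leaves room for infinitely many leaves. *)
Definition height (n : nat) : R := n.+3%:R^-1.

Lemma height_lt m n : (height m < height n) = (n < m)%N.
Proof. by rewrite ltf_pV2 ?posrE ?ltr0n // ltr_nat. Qed.

Lemma height_inj : injective height.
Proof. by move=> m n /invr_inj/eqP; rewrite eqr_nat => /eqP[]. Qed.

Lemma height_bounds n : 0 < height n < 2^-1.
Proof. by rewrite invr_gt0 ltr0n ltf_pV2 ?posrE ?ltr0n // ltr_nat. Qed.

(* For 0 <= x <= 1 and 0 <= h <= 1/2, a parametrization of the triangle with
   vertices (2i, 0), (2i + 1, j) and (2i + 1/2, (j + 1)/2), in which h = 0 on the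
   side from (2i, 0) to (2i + 1, j). *)
Definition chart (i j : nat) (h x : R) : R * R :=
  (2 * i%:R + x, j%:R * x + 2 * h * Num.min x (1 - x)).

Lemma natr_lt_add1 m n : (m < n)%N -> m%:R + 1 <= n%:R :> R.
Proof. by rewrite natr1 ler_nat. Qed.

Lemma column_inj i x i' x' : 0 <= x <= 1 -> 0 <= x' <= 1 ->
  2 * i%:R + x = 2 * i'%:R + x' :> R -> i = i' /\ x = x'.
Proof.
move=> x01 x01' e.
have ii' : i = i' by case: (ltngtP i i') => // /natr_lt_add1 ?; exfalso; lra.
by split=> //; move: e; rewrite ii'; lra.
Qed.

(** Since [2 * h < 1] and [m <= x], the second coordinate lies between [j x] and [(j + 1) x], which
    determines [j]. *)
Lemma chart_inj i j h x i' j' h' x' :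
  0 < x < 1 -> 0 <= h < 2^-1 -> 0 < x' < 1 -> 0 <= h' < 2^-1 ->
  chart i j h x = chart i' j' h' x' -> [/\ i = i', j = j', h = h' & x = x'].
Proof.
move=> x01 h01 x01' h01' [e1 e2].
have [||? ?] := column_inj _ _ e1; [lra | lra | subst i' x'].
move: e2; have : 0 < Num.min x (1 - x) by rewrite lt_min; lra.
have : Num.min x (1 - x) <= x by rewrite ge_min lexx.
move: (Num.min x (1 - x)) => m mx m0 e2.
have jj' : j = j' by case: (ltngtP j j') => // /natr_lt_add1 ?; exfalso; nra.
subst j'; split=> //.
have : (h - h') * m = 0 by lra.
by move/eqP; rewrite mulf_eq0 (gt_eqF m0) orbF subr_eq0 => /eqP.
Qed.

Definition place (u : fan_vertex) : R * R :=
  match u with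
  | Apex i => (2 * i%:R, 0)
  | Centre i j => (2 * i%:R + 1, j%:R)
  | Leaf i j n => chart i j (height n) 2^-1
  end.

(* The relative interior of the edge uv, or, for u = v, a leaf. *)
Definition cell (u v : fan_vertex) (i j : nat) (h x : R) : Prop :=
  match u, v with
  | Apex i1, Centre i2 j2 => [/\ i1 = i, i2 = i, j2 = j, h = 0 & 0 < x < 1]
  | Apex i1, Leaf i2 j2 n =>
    [/\ i1 = i, i2 = i, j2 = j, h = height n & 0 < x < 2^-1]
  | Centre i1 j1, Leaf i2 j2 n =>
    [/\ i1 = i /\ j1 = j, i2 = i, j2 = j, h = height n & 2^-1 < x < 1]
  | Leaf i1 j1 n1, Leaf i2 j2 n2 =>
    [/\ i1 = i /\ j1 = j, i2 = i, j2 = j, x = 2^-1 &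
        n1 = n2 /\ h = height n1 \/ n2 = n1.+1 /\ height n2 < h < height n1]
  | _, _ => False
  end.

Lemma cell_bounds u v i j h x : cell u v i j h x -> 0 < x < 1 /\ 0 <= h < 2^-1.
Proof.
case: u v => [i1|i1 j1|i1 j1 n1] [i2|i2 j2|i2 j2 n2] //=; case=> _ _ _.
- by move=> -> ?; split=> //; lra.
- by move=> -> ?; have := height_bounds n2; split; lra.
- by move=> -> ?; have := height_bounds n2; split; lra.
- move=> -> H; have := height_bounds n1; have := height_bounds n2.
  by case: H => -[_ ?]; split; lra.
Qed.

Lemma cell_inj u v u' v' i j h x :
  cell u v i j h x -> cell u' v' i j h x -> u = u' /\ v = v'.
Proof.
have step m n : height n.+1 < height m < height n -> False.
  by rewrite !height_lt; lia.
have pos n : 0 < height n by case/andP: (height_bounds n).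
have step_step n m h' : height n.+1 < h' < height n -> height m.+1 < h' < height m -> n = m.
  move=> /andP[a b] /andP[c d].
  by have := lt_trans a d; have := lt_trans c b; rewrite !height_lt; lia.
case: u v u' v' => [i1|i1 j1|i1 j1 n1] [i2|i2 j2|i2 j2 n2]
  [i3|i3 j3|i3 j3 n3] [i4|i4 j4|i4 j4 n4] //= H H'.
all: repeat match goal with
  | H : _ /\ _ |- _ => destruct H
  | H : and5 _ _ _ _ _ |- _ => destruct H
  | H : _ \/ _ |- _ => destruct H
  end.
all: repeat match goal with H : @eq nat ?a ?b |- _ => first [subst a | subst b] end.
all: try solve [by [] | exfalso; match goal with
  | H1 : ?h = 0, H2 : ?h = height ?n |- _ =>
    by have := pos n; rewrite -H2 H1 ltxx
  | H1 : ?h = height ?n, H2 : is_true (height ?m.+1 < ?h < height ?m) |- _ =>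
    by rewrite H1 in H2; exact: step H2
  | H1 : ?h = 0, H2 : is_true (height ?m.+1 < ?h < height ?m) |- _ =>
    by have := pos m.+1; move: H2; rewrite H1; lra
  end].
all: try match goal with
  | H1 : ?h = height ?n, H2 : ?h = height ?m |- _ =>
    have ? := height_inj (etrans (esym H1) H2); subst m
  | H1 : is_true (height ?n.+1 < ?h < height ?n),
    H2 : is_true (height ?m.+1 < ?h < height ?m) |- _ =>
    have ? := step_step n m _ H1 H2; subst m end.
all: try solve [by [] | exfalso; lra].
Qed.

Lemma place_inj : injective place.
Proof.
have r0 : 0 <= (0 : R) <= 1 by lra.
have r1 : 0 <= (1 : R) <= 1 by lra.
have rh : 0 <= (2^-1 : R) <= 1 by lra.
have half : 0 < (2^-1 : R) < 1 by lra.
have neq0 : (2^-1 : R) <> 0 by lra.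
have neq1 : (2^-1 : R) <> 1 by lra.
have hn n : 0 <= height n < 2^-1 by case/andP: (height_bounds n) => /ltW -> ->.
move=> [i|i j|i j n] [i'|i' j'|i' j' n'] /=.
- by case; rewrite -[2 * i%:R]addr0 -[2 * i'%:R]addr0 => /(column_inj r0 r0)[->].
- by case; rewrite -[2 * i%:R]addr0 => /(column_inj r0 r1)[_ /eqP]; rewrite eq_sym oner_eq0.
- by case; rewrite -[2 * i%:R]addr0 => /(column_inj r0 rh)[_ /esym].
- by case; rewrite -[2 * i'%:R]addr0 => /(column_inj r1 r0)[_ /eqP]; rewrite oner_eq0.
- by case=> /(column_inj r1 r1)[-> _] /eqP; rewrite eqr_nat => /eqP ->.
- by case=> /(column_inj r1 rh)[_ /esym].
- by case; rewrite -[2 * i'%:R]addr0 => /(column_inj rh r0)[_].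
- by case=> /(column_inj rh r1)[_].
- by move/(chart_inj half (hn n) half (hn n')) => [-> -> /height_inj -> _].
Qed.

Lemma place_cell w i j h x : 0 < x < 1 -> 0 <= h < 2^-1 ->
  place w = chart i j h x -> cell w w i j h x.
Proof.
move=> x01 h01; have x01' : 0 <= x <= 1 by lra.
case: w => [i'|i' j'|i' j' n] /= E.
- case: E; rewrite -[2 * i'%:R]addr0 => E _.
  by have [||_ ?] := column_inj _ _ E; lra.
- by case: E => E _; have [||_ ?] := column_inj _ _ E; lra.
- have half01 : 0 < (2^-1 : R) < 1 by lra.
  have hn : 0 <= height n < 2^-1 by case/andP: (height_bounds n) => /ltW -> ->.
  have [-> -> <- <-] := chart_inj half01 hn x01 h01 E.
  by split=> //; left.
Qed.

Definition on_edge u v (q : R * R) : Prop :=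
  [\/ q = place u, q = place v | exists i j h x,
     q = chart i j h x /\ (cell u v i j h x \/ cell v u i j h x)].

Lemma segment_on_edge u v q :
  fan_adj u v -> segment (place u) (place v) q -> on_edge u v q.
Proof.
have swap a b : on_edge a b q -> on_edge b a q.
  case=> [?|?|[i [j [h [x [? H]]]]]]; [exact: Or32 | exact: Or31 | apply: Or33].
  by exists i, j, h, x; split=> //; case: H; [right | left].
wlog uv : u v / fan_edge u v.
  move=> W [uv|vu]; first by apply: W => //; left.
  by rewrite segmentC => ?; apply/swap/W => //; left.
move=> _ [t + <-]; rewrite set_itvcc => /andP[]; rewrite le_eqVlt => /predU1P[<- _|t0].
  by apply: Or31; rewrite /segment_point !mul0r !addr0; case: (place u).
rewrite le_eqVlt => /predU1P[->|t1].
  apply: Or32; rewrite /segment_point !mul1r.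
  by case: (place v) => a b /=; congr pair; ring.
apply: Or33; have minl (x : R) : 0 < x <= 2^-1 -> Num.min x (1 - x) = x.
  by move=> x01; apply: min_l; lra.
have minr (x : R) : 2^-1 <= x < 1 -> Num.min x (1 - x) = 1 - x.
  by move=> x01; apply: min_r; lra.
case: u v uv => [i|i j|i j n] [i'|i' j'|i' j' n'] //=.
- move=> <-; exists i, j', 0, t; split; last by left; rewrite /= t0.
  by rewrite /segment_point /chart /=; congr pair; ring.
(* A line of constant height in [chart] is bent at [x = 1/2], and an edge from apex or centre to
   leaf is one half of it; hence the factor 1/2. *)
- move=> <-; exists i, j', (height n'), (t / 2); split.
    by rewrite /segment_point /chart /= !minl; [congr pair; field | lra | lra].
  by left; split=> //; lra.
- case=> <- <-; exists i, j, (height n'), (1 - t / 2); split.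
    by rewrite /segment_point /chart /= !minr; [congr pair; field | lra | lra].
  by left; split=> //; lra.
- case=> <- <- ->; exists i, j, (height n + t * (height n.+1 - height n)), 2^-1; split.
    by rewrite /segment_point /chart /= !minl; [congr pair; field | lra].
  left; split=> //; right; split=> //.
  have : height n.+1 < height n by rewrite height_lt.
  by move=> ?; apply/andP; split; nra.
Qed.

Lemma fan_plane : embeds_in_plane R fan_adj.
Proof.
have on_vertex u v w : fan_adj u v -> segment (place u) (place v) (place w) -> w = u \/ w = v.
  move=> uv /(segment_on_edge uv)[/place_inj ->|/place_inj ->|]; [by left | by right |].
  move=> [i [j [h [x [E H]]]]].
  have [x01 h01] : 0 < x < 1 /\ 0 <= h < 2^-1 by case: H => /cell_bounds.
  have ww := place_cell x01 h01 E.
  by case: H => /(cell_inj ww)[]; [left | right].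
exists place, (fun u v => segment (place u) (place v)); split.
- exact: place_inj.
- move=> u v uv; apply: segment_arc => /place_inj E.
  by move: uv; rewrite E /fan_adj; case: v {E} => [?|? ?|? ? n] /= [] // [] _ _ /eqP;
    rewrite ltn_eqF.
- by move=> u v _; exact: segmentC.
- by move=> u v w; exact: on_vertex.
move=> x y z w xy zw neq q [qxy qzw].
have [q1|q1|[i [j [h [X [E H]]]]]] := segment_on_edge xy qxy.
- rewrite q1 in qzw *; exists x => //; split; first by left.
  by case: (on_vertex _ _ _ zw qzw) => ->; [left | right].
- rewrite q1 in qzw *; exists y => //; split; first by right.
  by case: (on_vertex _ _ _ zw qzw) => ->; [left | right].
have [q1|q1|[i' [j' [h' [X' [E' H']]]]]] := segment_on_edge zw qzw.
- rewrite q1 in qxy *; exists z => //; split; last by left.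
  by case: (on_vertex _ _ _ xy qxy) => ->; [left | right].
- rewrite q1 in qxy *; exists w => //; split; last by right.
  by case: (on_vertex _ _ _ xy qxy) => ->; [left | right].
exfalso; apply: neq.
have [x01 h01] : 0 < X < 1 /\ 0 <= h < 2^-1 by case: H => /cell_bounds.
have [x01' h01'] : 0 < X' < 1 /\ 0 <= h' < 2^-1 by case: H' => /cell_bounds.
have [? ? ? ?] := chart_inj x01 h01 x01' h01' (etrans (esym E) E'); subst i' j' h' X'.
have setC a b : [set a; b] = [set b; a] :> set fan_vertex by rewrite setUC.
by case: H H' => c [] c'; have [-> ->] := cell_inj c c'; rewrite // setC.
Qed.

End Drawing.

(** * Powers of an element *)

Local Open Scope classical_set_scope.
Local Open Scope card_scope.

Arguments spow {S} a n : simpl never.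

Lemma card_eqW (T U : Type) (A : set T) (B : set U) : A #= B -> A #<= B.
Proof. by case/card_eqPle. Qed.

Section Powers.
Variable S : semigroupType.
Implicit Types x y z : S.

Lemma spowS z n : 0 < n -> spow z n.+1 = (z * spow z n)%g.
Proof. by case: n. Qed.

Lemma spowD z m n : 0 < m -> 0 < n -> spow z (m + n) = (spow z m * spow z n)%g.
Proof.
move=> m0 n0; elim: m m0 => // -[_ _|m IH _]; first by rewrite add1n spowS.
by rewrite addSn spowS ?addn_gt0 // IH // [spow z m.+2]spowS // mulgA.
Qed.

Lemma spowM z m n : 0 < m -> 0 < n -> spow (spow z m) n = spow z (m * n).
Proof.
move=> m0; elim: n => // -[_ _|n IH _]; first by rewrite muln1.
by rewrite [LHS]spowS // IH // [m * n.+2]mulnS spowD ?muln_gt0 ?m0.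
Qed.

Lemma powers_spow z n : 0 < n -> powers z (spow z n).
Proof. by move=> n0; exists n. Qed.

Lemma powers_refl z : powers z z.
Proof. exact: (powers_spow z (n := 1)). Qed.

Lemma powers_trans x y z : powers z y -> powers y x -> powers z x.
Proof.
move=> [m m0 <-] [n n0 <-]; rewrite spowM //; apply: powers_spow.
by rewrite muln_gt0 m0.
Qed.

(* The element z has index m and period r. *)
Definition has_type z m r : Prop :=
  [/\ 0 < m, 0 < r, spow z (m + r) = spow z m &
      forall i j, 0 < i < m + r -> 0 < j < m + r -> spow z i = spow z j -> i = j].

(** The normal form of an exponent. As it computes, equality of powers of an element of known type
    is decided by evaluation. *)
Definition reduce m r n := if n < m + r then n else m + (n - m) %% r.

Section FixedType.
Variables (z : S) (m r : nat).
Hypothesis zP : has_type z m r.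

Lemma spow_reduce n : spow z n = spow z (reduce m r n).
Proof.
case: zP => m0 r0 per _; rewrite /reduce; case: ltnP => // mrn.
have perk k : spow z (m + r + k) = spow z (m + k).
  by case: k => [|k]; rewrite ?addn0 // spowD ?addn_gt0 ?m0 // per -spowD.
have perq q k : spow z (m + (q * r + k)) = spow z (m + k).
  elim: q => // q IH; rewrite mulSn -addnA addnA perk; exact: IH.
by rewrite -[in LHS](subnKC (leq_trans (leq_addr r m) mrn)) [in LHS](divn_eq (n - m) r) perq.
Qed.

Lemma reduce_bounds n : 0 < n -> 0 < reduce m r n < m + r.
Proof.
case: zP => m0 r0 _ _ n0; rewrite /reduce; case: (ltnP n) => [->|_]; first by rewrite n0.
by rewrite addn_gt0 m0 ltn_add2l ltn_mod.
Qed.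

Lemma spow_eq i j : 0 < i -> 0 < j ->
  (spow z i == spow z j) = (reduce m r i == reduce m r j).
Proof.
move=> i0 j0; rewrite spow_reduce (spow_reduce j).
apply/eqP/eqP => [|-> //]; case: zP => _ _ _; apply; exact: reduce_bounds.
Qed.

Lemma powers_type : powers z = [set spow z n.+1 | n in `I_(m + r).-1].
Proof.
case: zP => m0 r0 _ _; apply/seteqP; split=> _ [n /= n0 <-].
  have /andP[a b] := reduce_bounds n0.
  have -> : spow z n = spow z (reduce m r n).-1.+1 by rewrite prednK // -spow_reduce.
  by exists (reduce m r n).-1 => //=; lia.
by exists n.+1.
Qed.

Lemma order_type : has_order z (m + r).-1.
Proof.
rewrite /has_order powers_type; apply: inj_card_eq => i j.
rewrite !inE /= => im jm; case: zP => m0 _ _ /(_ i.+1 j.+1) + e => /(_ _ _ e).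
by move=> H; apply: succn_inj; apply: H; lia.
Qed.

Lemma index_type : has_index z m.
Proof.
case: (zP) => m0 r0 per inj; split.
  split=> //; exists (m + r); split; [lia | lia | by []].
move=> x [x0 [y [y0 xy /eqP]]]; rewrite spow_eq // /reduce => /eqP.
by case: ltnP => ?; case: ltnP => ?; lia.
Qed.

End FixedType.

Lemma index_unique z m m' : has_index z m -> has_index z m' -> m = m'.
Proof. by move=> [a b] [c d]; apply/eqP; rewrite eqn_leq b // d. Qed.

Lemma type_of_repeat z i j : 0 < i < j -> spow z i = spow z j ->
  exists m r, has_type z m r /\ m + r <= j.
Proof.
move=> ij e.
(* The least exponent whose power repeats an earlier one is the sum of index and period. *)
pose P n := [exists k : 'I_n, (0 < k) && (spow z k == spow z n)].
have exP : exists n, P n.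
  case/andP: ij => i0 ij; exists j; apply/existsP; exists (Ordinal ij).
  by rewrite /= i0 e eqxx.
case: (ex_minnP exP) => n /existsP[k /andP[k0 /eqP kn]] min.
have nj : n <= j.
  apply: min; case/andP: ij => i0 ij; apply/existsP; exists (Ordinal ij).
  by rewrite /= i0 e eqxx.
have kltn := ltn_ord k.
exists k, (n - k); rewrite subnKC ?(ltnW kltn) //; split=> //.
have noP a b : 0 < a -> a < b -> b < n -> spow z a = spow z b -> False.
  move=> a0 ab bn eab; have : P b by apply/existsP; exists (Ordinal ab); rewrite /= a0 eab eqxx.
  by move/min; rewrite leqNgt bn.
split=> //; rewrite ?subn_gt0 // ?subnKC ?(ltnW kltn) //.
move=> a b /andP[a0 an] /andP[b0 bn] eab.
by case: (ltngtP a b) => // ab; exfalso; [apply: (noP a b) | apply: (noP b a)].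
Qed.

Lemma repeat_or_injective z n :
  (exists2 ij : nat * nat, [&& 0 < ij.1, ij.1 < ij.2 & ij.2 <= n] & spow z ij.1 = spow z ij.2) \/
  (forall i j, 0 < i <= n -> 0 < j <= n -> spow z i = spow z j -> i = j).
Proof.
have [?|no] := pselect (exists2 ij : nat * nat, [&& 0 < ij.1, ij.1 < ij.2 & ij.2 <= n] &
  spow z ij.1 = spow z ij.2); [by left | right => i j /andP[i0 im] /andP[j0 jn] e].
case: (ltngtP i j) => // ij; exfalso; apply: no; [exists (i, j) | exists (j, i)] => //=; lia.
Qed.

Lemma type_of_finite z n :
  powers z #<= `I_n -> exists m r, has_type z m r /\ m + r <= n.+1.
Proof.
move=> fin; have [[[i j] /= /and3P[i0 ij jn] e]|inj] := repeat_or_injective z n.+1.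
  have [m [r [zP mrj]]] := type_of_repeat (introT andP (conj i0 ij)) e.
  by exists m, r; split=> //; exact: leq_trans jn.
exfalso; have : `I_n.+1 #<= `I_n; last by rewrite card_le_II ltnn.
apply: card_le_trans fin.
have sub : [set spow z k.+1 | k in `I_n.+1] `<=` powers z by move=> _ [k _ <-]; exists k.+1.
apply: card_le_trans (subset_card_le sub); apply/card_eqW/card_esym.
by apply: inj_card_eq => i j; rewrite !inE /= => im jm e; have [] := inj i.+1 j.+1 im jm e.
Qed.

Lemma type_of_order z m r : has_order z (m + r).-1 -> has_index z m -> 0 < r ->
  has_type z m r.
Proof.
move=> ord ind r0; have [m' [r' [zP _]]] := type_of_finite (card_eqW ord).
have em := index_unique (index_type zP) ind; subst m'.
have /card_eq_II e := card_eq_trans (card_esym (order_type zP)) ord.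
by have -> : r = r' by case: zP => ? ? _ _; lia.
Qed.

(** From the second power on, the powers of [z] lie in a group of order 3, where [u = u^4]; this
    fails for [x]. *)
Lemma type23_top x z : has_type x 2 3 -> has_type z 2 3 -> powers z x -> x = z.
Proof.
move=> xP zP [n n0]; rewrite (spow_reduce zP).
have := reduce_bounds zP n0; case: (reduce 2 3 n) => [|[|k]] // k5 e.
suff : spow x 1 == spow x 4 by rewrite (spow_eq xP).
by rewrite -e !spowM // (spow_eq zP) //; case: k {e} k5 => [|[|[|k]]].
Qed.

End Powers.

(** * Necessity of the two conditions *)

Section NonPlanar.
Variables (R : realType) (S : semigroupType).
Hypothesis planarS : planar R (@enhanced_power_graph S).

Lemma planar_pullback n (f : 'I_n -> S) : injective f ->
  embeds_in_plane R (fun i j => enhanced_power_graph (f i) (f j)).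
Proof.
move=> fI; have cX : countable (range f).
  by apply: finite_set_countable; apply: finite_image; exact: finite_finset.
pose g (i : 'I_n) : range f := SigSub (mem_set (imageT f i)).
apply: (@embeds_in_plane_inj R _ _ _ g _ (planarS cX)).
by move=> i j /(congr1 \val) /fI.
Qed.

Lemma planar_order_le4 (a : S) : powers a #<= `I_4.
Proof.
have [[[i j] /= /and3P[i0 ij jn] e]|inj] := repeat_or_injective a 5.
  have [m [r [aP mrj]]] := type_of_repeat (introT andP (conj i0 ij)) e.
  apply: card_le_trans (card_eqW (order_type aP)) _.
  by rewrite card_le_II; lia.
pose f (i : 'I_5) := spow a i.+1.
have fI : injective f.
  move=> i j /inj e; apply/val_inj/succn_inj/e; exact: ltn_ord.
case: (@K5_not_plane R); apply: embeds_in_plane_sub (planar_pullback fI) => i j ij.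
split; first by move/fI => e; rewrite e eqxx in ij.
by exists a; split; apply: powers_spow.
Qed.

Lemma planar_no_tops : ~ (exists a b c : S,
  [/\ a <> b, a <> c & b <> c] /\
  [/\ has_order a 4, has_order b 4 & has_order c 4] /\
  [/\ has_index a 2, has_index b 2 & has_index c 2] /\
  powers a `&` powers b `&` powers c #= `I_3).
Proof.
move=> [a [b [c [[ab ac bc] [[oa ob oc] [[ia ib ic] I3]]]]]].
have aP : has_type a 2 3 by apply: type_of_order.
have bP : has_type b 2 3 by apply: type_of_order.
have cP : has_type c 2 3 by apply: type_of_order.
case/eq_cardSP: I3 => x0 Ix0 /eq_cardSP[x1 [Ix1 x10] /eq_cardSP[x2 [[Ix2 x20] x21] _]].
have tops x : (powers a `&` powers b `&` powers c) x -> x \notin [:: a; b; c].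
  move=> [[xa xb] xc]; rewrite !inE; apply/or3P => -[] /eqP e; subst x.
  - by apply: ab; apply: type23_top xb.
  - by apply: ab; apply/esym; apply: type23_top xa.
  - by apply: ac; apply/esym; apply: type23_top xa.
pose s := [:: a; b; c; x0; x1; x2]; pose f (i : 'I_6) := nth a s i.
have us : uniq s.
  have {}x10 : x1 <> x0 := x10; have {}x20 : x2 <> x0 := x20.
  have {}x21 : x2 <> x1 := x21.
  have neq x : x \notin [:: a; b; c] -> [/\ x <> a, x <> b & x <> c].
    by rewrite !inE !negb_or => /and3P[/eqP ? /eqP ? /eqP].
  have [? ? ?] := neq _ (tops _ Ix0); have [? ? ?] := neq _ (tops _ Ix1).
  have [? ? ?] := neq _ (tops _ Ix2).
  rewrite /s /= !inE !negb_or; do !(apply/andP; split) => //;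
    by apply/eqP; first [assumption | apply: nesym; assumption].
have fI : injective f.
  move=> i j /eqP; rewrite nth_uniq // => /eqP; exact: val_inj.
have adj (i j : 'I_6) : i < 3 -> 2 < j -> enhanced_power_graph (f i) (f j).
  move=> i3 j3; split; first by move/fI => e; move: i3 j3; rewrite e; lia.
  exists (f i); split; first exact: powers_refl.
  have : (powers a `&` powers b `&` powers c) (f j).
    by case: j j3 => -[|[|[|[|[|[|]]]]]] // ? ? /=.
  by case: i i3 => -[|[|[|]]] // ? ? [[]] /=.
case: (@K33_not_plane R); apply: embeds_in_plane_sub (planar_pullback fI) => i j.
case: (ltnP i 3) => i3; case: (ltnP j 3) => j3 //= _; first exact: adj.
by apply: enhanced_power_graph_sym; exact: adj.
Qed.

End NonPlanar.

(** * Embedding into the fan graph *)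

(** The first equation that holds determines index and period; (3, 1) is the default. *)
Definition type_of (e : nat -> nat -> bool) : nat * nat :=
  if e 2 1 then (1, 1) else if e 3 1 then (1, 2) else if e 4 1 then (1, 3)
  else if e 5 1 then (1, 4) else if e 3 2 then (2, 1) else if e 4 2 then (2, 2)
  else if e 5 2 then (2, 3) else (3, 1).

(** All types of order at most 4 except (3, 2) and (4, 1), which have order 4 and index above 2. *)
Definition small_types :=
  [:: (1, 1); (1, 2); (1, 3); (1, 4); (2, 1); (2, 2); (2, 3); (3, 1)].

Section Coding.
Variables (S : semigroupType) (h : S -> nat).
Implicit Types g x y z : S.

Hypothesis finS : forall a : S, powers a #<= `I_4.
Hypothesis index_order4 : forall a : S, has_order a 4 -> has_index a 1 \/ has_index a 2.

Definition ptype x := type_of (fun i j => spow x i == spow x j).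

Lemma ptype_spow z m r k : has_type z m r -> 0 < k ->
  ptype (spow z k) = type_of (fun i j => reduce m r (k * i) == reduce m r (k * j)).
Proof.
move=> zP k0; rewrite /ptype /type_of !spowM // !(spow_eq zP) ?muln_gt0 ?k0 //.
Qed.

Lemma ptypeP z : exists m r, [/\ has_type z m r, ptype z = (m, r) & (m, r) \in small_types].
Proof.
have [m [r [zP mr5]]] := type_of_finite (finS z).
have mr : (m, r) \in small_types.
  case: (zP) => m0 r0 _ _.
  have m2 : m + r = 5 -> m <= 2.
    move=> mr; have := order_type zP; rewrite mr.
    by case/index_order4 => /(index_unique (index_type zP)) ->; lia.
  have : (m, r) \in [seq (m, r) | m <- [:: 1; 2; 3; 4], r <- [:: 1; 2; 3; 4]].
    by apply/allpairsP; exists (m, r); rewrite !inE /=; split=> //; lia.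
  rewrite /=; clear -m2 mr5.
  rewrite !inE => H; move: mr5 m2.
  by repeat (case/orP: H => [/eqP[-> ->]|H] //; try by move=> _ /(_ erefl)); case/eqP: H => -> ->.
exists m, r; split=> //.
have := ptype_spow zP (k := 1) isT; rewrite {1}/spow /= => ->.
by move: mr {zP mr5}; rewrite !inE; do 7 (case/orP => [/eqP[-> ->] //|]); move/eqP => [-> ->].
Qed.

(* If g generates a group of order 3, a choice of one of g, g^2 that does not
   depend on the generator; lo3 does the same for the two generators of a cyclic
   group of order 4. *)
Definition lo g := choose (pred2 g (spow g 2)) g.
Definition hi g := if lo g == g then spow g 2 else g.
Definition lo3 x := choose (pred2 x (spow x 3)) x.

(** For period 3, the chosen generator of the group of order 3; for (1, 4) and (2, 2), the
    involution of the group part; for (3, 1), the square, of type (2, 1). Elements of type (1, 2) or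
    (2, 1) are their own centres. *)
Definition centre x :=
  match ptype x with
  | (1, 3) | (2, 3) => lo (spow x 4)
  | (1, 4) | (3, 1) => spow x 2
  | (2, 2) => spow x 3
  | _ => x
  end.

(** A common name for the leaves of one path; [rank] is the position on it. *)
Definition rep x :=
  match ptype x with
  | (1, 4) => lo3 x
  | (2, 3) => hi (spow x 4)
  | _ => x
  end.

(** The group element of the path takes the middle position 1. Of the elements of type (2, 3)
    attached to it, the one with the least [h] gets 0 and any other gets 2; condition (ii) allows
    only one other. *)
Definition rank x : nat :=
  match ptype x with
  | (1, 4) => lo3 x != x
  | (1, 3) => 1
  | (2, 3) =>
    if `[< exists w, [/\ ptype w = (2, 3), hi (spow w 4) = hi (spow x 4) & h w < h x] >]
    then 2 else 0
  | _ => 0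
  end.

(* The factor 3 leaves room for paths with vertices of rank 0, 1, 2. *)
Definition code x : fan_vertex :=
  if spow x 2 == x then Apex (h (spow x 12))
  else if centre x == x then Centre (h (spow x 12)) (h x)
  else Leaf (h (spow x 12)) (h (centre x)) (3 * h (rep x) + rank x).

(** * Adjacent elements have adjacent codes *)

Lemma lo_or g : lo g = g \/ lo g = spow g 2.
Proof.
have /orP[] : pred2 g (spow g 2) (lo g) by apply: chooseP; rewrite /= eqxx.
  by move/eqP; left.
by move/eqP; right.
Qed.

Lemma lo3_or g : lo3 g = g \/ lo3 g = spow g 3.
Proof.
have /orP[] : pred2 g (spow g 3) (lo3 g) by apply: chooseP; rewrite /= eqxx.
  by move/eqP; left.
by move/eqP; right.
Qed.

(** [choose] depends only on the predicate, and [g] and its square define the same one. *)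
Lemma lo_sqr g : spow g 4 = g -> lo (spow g 2) = lo g.
Proof.
move=> g4; rewrite /lo spowM // g4 (eq_choose (Q := pred2 g (spow g 2))); last first.
  by move=> u /=; rewrite orbC.
by apply: choose_id; rewrite /= eqxx ?orbT.
Qed.

Lemma lo3_cube g : spow g 9 = g -> lo3 (spow g 3) = lo3 g.
Proof.
move=> g4; rewrite /lo3 spowM // g4 (eq_choose (Q := pred2 g (spow g 3))); last first.
  by move=> u /=; rewrite orbC.
by apply: choose_id; rewrite /= eqxx ?orbT.
Qed.

(** The exponent 12 is a multiple of every period in [small_types] and exceeds every index, so the
    twelfth power is the idempotent power of an element. *)
Lemma apex_adj x y : spow x 2 = x -> spow y 2 <> y -> spow x 12 = spow y 12 ->
  fan_adj (code x) (code y).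
Proof.
move=> /eqP x2 /eqP/negPf y2 e; rewrite /code x2 y2 e.
by case: ifP => _; left.
Qed.

Lemma centre_adj x y : spow x 2 <> x -> spow y 2 <> y -> spow x 12 = spow y 12 ->
  centre x = x -> centre y = x -> x <> y -> fan_adj (code x) (code y).
Proof.
move=> /eqP/negPf x2 /eqP/negPf y2 e cx cy /eqP/negPf xy.
by rewrite /code x2 y2 e cx cy eqxx xy; left.
Qed.

Lemma leaf_adj x y : spow x 2 <> x -> spow y 2 <> y -> spow x 12 = spow y 12 ->
  centre x = centre y -> centre x <> x -> centre y <> y -> rep x = rep y ->
  rank y = (rank x).+1 -> fan_adj (code x) (code y).
Proof.
move=> /eqP/negPf x2 /eqP/negPf y2 e c /eqP/negPf cx /eqP/negPf cy r b.
by rewrite /code x2 y2 e cx cy c r b addnS; left.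
Qed.

Lemma fan_adjC u v : fan_adj u v -> fan_adj v u.
Proof. by case; [right | left]. Qed.

Ltac decide_powers zP eqS neS :=
  rewrite /centre /rep /rank ?(ptype_spow zP) //= ?spowM //;
  first [by apply: eqS | by apply: neS].

Lemma code_adj x y : enhanced_power_graph x y -> fan_adj (code x) (code y).
Proof.
move=> [xy [z [zx zy]]].
have [m [r [zP _ mr]]] := ptypeP z.
have red u : powers z u -> exists2 i, 0 < i < m + r & u = spow z i.
  move=> [n n0 <-]; exists (reduce m r n); first exact: (reduce_bounds zP).
  by rewrite -(spow_reduce zP).
have [i ib xi] := red x zx; have [j jb yj] := red y zy; clear zx zy; subst x y.
have neq : i != j by apply/eqP => e; apply: xy; rewrite e.
wlog ij : i j ib jb {xy neq} / i < j.
  move=> W; move: neq; rewrite neq_ltn => /orP[]; first exact: W.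
  by move=> ?; apply: fan_adjC; exact: W.
have eqS a b : 0 < a -> 0 < b -> (reduce m r a == reduce m r b) = true -> spow z a = spow z b.
  by move=> a0 b0; rewrite -(spow_eq zP) // => /eqP.
have neS a b : 0 < a -> 0 < b -> (reduce m r a == reduce m r b) = false -> spow z a <> spow z b.
  by move=> a0 b0; rewrite -(spow_eq zP) // => /eqP.
have centres a b : 0 < a -> 0 < b -> spow z a <> spow z b ->
    spow (spow z a) 2 <> spow z a -> spow (spow z b) 2 <> spow z b ->
    spow (spow z a) 12 = spow (spow z b) 12 ->
    centre (spow z a) = spow z a -> centre (spow z b) = spow z a ->
    fan_adj (code (spow z a)) (code (spow z b)).
  by move=> *; apply: centre_adj.
have type23_facts : (m, r) = (2, 3) -> [/\ spow z 4 <> spow z 2,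
    centre (spow z 1) = lo (spow z 4), centre (spow z 2) = lo (spow z 4) &
    centre (spow z 4) = lo (spow z 4)].
  case=> ? ?; subst m r; split; first by apply: neS.
  - by rewrite /centre (ptype_spow zP).
  - rewrite /centre (ptype_spow zP) //= spowM //.
    have -> : spow z 8 = spow z 2 by apply: eqS.
    by rewrite -lo_sqr spowM //; apply: eqS.
  - by rewrite /centre (ptype_spow zP) //= spowM //; congr lo; apply: eqS.
have type23_adj a : (m, r) = (2, 3) -> (a == 2) || (a == 4) ->
    fan_adj (code (spow z 1)) (code (spow z a)).
  move=> mr23 a24; have [z42 c1 c2 c4] := type23_facts mr23.
  have a0 : 0 < a by case/orP: a24 => /eqP ->.
  have ca : centre (spow z a) = lo (spow z 4) by case/orP: a24 => /eqP ->.
  case: mr23 => ? ?; subst m r.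
  (* Either this power is the centre, or it has rank 1 and so is next to [z], whose rank is 0 or
     2. *)
  have [loa|loa] := pselect (lo (spow z 4) = spow z a).
    by apply/fan_adjC/centres; rewrite ?c1 ?ca //;
      case/orP: a24 => /eqP ?; subst a; decide_powers zP eqS neS.
  have hia : hi (spow z 4) = spow z a.
    have z48 : spow (spow z 4) 2 = spow z 2 by rewrite spowM //; apply: eqS.
    rewrite /hi z48; case: eqP => lo4; case/orP: a24 => /eqP ?; subst a => //.
    by case: loa; case: (lo_or (spow z 4)) => // ->; rewrite z48.
  have ranka : rank (spow z a) = 1.
    by case/orP: a24 => /eqP ?; subst a; rewrite /rank (ptype_spow zP).
  have repa : rep (spow z a) = spow z a.
    by case/orP: a24 => /eqP ?; subst a; rewrite /rep (ptype_spow zP).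
  have rep1 : rep (spow z 1) = spow z a by rewrite /rep (ptype_spow zP).
  have rank1 : rank (spow z 1) = 0 \/ rank (spow z 1) = 2.
    by rewrite /rank (ptype_spow zP) //=; case: ifP; [right | left].
  case: rank1 => rank1; [|apply: fan_adjC]; apply: leaf_adj;
    rewrite ?c1 ?ca ?repa ?rep1 ?ranka ?rank1 //;
    try solve [by move=> lo1; case: (lo_or (spow z 4)) => e; move: lo1;
      rewrite e ?spowM //; apply: neS | by apply: nesym];
    case/orP: a24 => /eqP ?; subst a; decide_powers zP eqS neS.
(* All types and all pairs of exponents: an idempotent is the apex, and a power that is its own
   centre is joined to its leaves. What remains depends on the choices made by [lo] and [lo3]. *)
move: mr; rewrite !inE; repeat match goal with |- is_true (_ || _) -> _ => case/orP end.
all: move=> /eqP[? ?]; subst m r.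
all: case: i ib ij => [|[|[|[|i]]]] //; case: j jb => [|[|[|[|[|j]]]]] // _ _ _; 
  try solve [apply: apex_adj; decide_powers zP eqS neS
    | apply: fan_adjC; apply: apex_adj; decide_powers zP eqS neS].
all: try solve [apply: centres; decide_powers zP eqS neS
  | apply: fan_adjC; apply: centres; decide_powers zP eqS neS].
(* Type (1, 3): one of the two generators is the centre of the other. *)
- have c1 : centre (spow z 1) = lo (spow z 1).
    by rewrite /centre (ptype_spow zP) //= spowM //; congr lo; apply: eqS.
  have c2 : centre (spow z 2) = lo (spow z 1).
    rewrite /centre (ptype_spow zP) //= spowM //.
    rewrite -(lo_sqr (g := spow z 1)) spowM //; last by apply: eqS.
    by congr lo; apply: eqS.
  case: (lo_or (spow z 1)) => lo1.
    by apply: centres; rewrite ?c1 ?c2 //; decide_powers zP eqS neS.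
  rewrite spowM // in lo1.
  by apply/fan_adjC/centres; rewrite ?c1 ?c2 //; decide_powers zP eqS neS.
(* Type (1, 4): the two generators are consecutive leaves of their common square. *)
- have l3 : lo3 (spow z 3) = lo3 (spow z 1).
    by rewrite -[RHS]lo3_cube spowM //; apply: eqS.
  have neq : spow z 3 <> spow z 1 by apply: neS.
  have [l1|l1] := lo3_or (spow z 1); [|rewrite spowM // in l1; apply: fan_adjC];
    apply: leaf_adj; try decide_powers zP eqS neS;
    rewrite /rep /rank !(ptype_spow zP) //= ?l3 ?l1 // eqxx.
  + by move/eqP/negPf: (nesym neq) => ->.
  + by move/eqP/negPf: neq => ->.
- exact: type23_adj.
- exact: type23_adj.
- have [_ _ c2 c4] := type23_facts erefl; case: (lo_or (spow z 4)) => lo4.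
    by apply/fan_adjC/centres; rewrite ?c2 ?c4 //; decide_powers zP eqS neS.
  have {}lo4 : lo (spow z 4) = spow z 2 by rewrite lo4 spowM //; apply: eqS.
  by apply: centres; rewrite ?c2 ?c4 //; decide_powers zP eqS neS.
Qed.

(** * Injectivity of the coding *)

Lemma hi_or g : hi g = g \/ hi g = spow g 2.
Proof. by rewrite /hi; case: ifP => _; [right | left]. Qed.

Lemma has_type_ptype x m r : ptype x = (m, r) -> has_type x m r.
Proof. by move=> xmr; have [m' [r' [xP + _]]] := ptypeP x; rewrite xmr => -[-> ->]. Qed.

Lemma ptype_small x : ptype x \in small_types.
Proof. by have [m [r [_ -> ?]]] := ptypeP x. Qed.

Lemma ptype_pow x m r k : ptype x = (m, r) -> 0 < k ->
  ptype (spow x k) = type_of (fun i j => reduce m r (k * i) == reduce m r (k * j)).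
Proof. by move=> /has_type_ptype; exact: ptype_spow. Qed.

Lemma ptype_rep x :
  ptype (rep x) = if ptype x == (2, 3) then (1, 3) else ptype x.
Proof.
have := ptype_small x; rewrite /rep !inE.
repeat match goal with |- is_true (_ || _) -> _ => case/orP end; move=> /eqP e; rewrite e //=.
- by case: (lo3_or x) => ->; rewrite ?(ptype_pow e).
- by case: (hi_or (spow x 4)) => ->; rewrite ?spowM // (ptype_pow e).
Qed.

Lemma rep_pow x : exists2 n, 0 < n & rep x = spow x n.
Proof.
have := ptype_small x; rewrite /rep !inE.
repeat match goal with |- is_true (_ || _) -> _ => case/orP end; move=> /eqP e; rewrite e //=;
  try by exists 1.
- by case: (lo3_or x) => ->; [exists 1 | exists 3].
- by case: (hi_or (spow x 4)) => ->; [exists 4 | exists 8; rewrite // spowM].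
Qed.

Lemma rank_lt3 x : rank x < 3.
Proof.
have := ptype_small x; rewrite /rank !inE.
repeat match goal with |- is_true (_ || _) -> _ => case/orP end; move=> /eqP e; rewrite e //=.
- by case: (_ == _).
- by case: ifP.
Qed.

(** Apart from [x], the powers of [x] form the group of order 3 generated by [hi (spow x 4)], and
    [x] is no power of [y] by [type23_top]. *)
Lemma top_powers x y : ptype x = (2, 3) -> ptype y = (2, 3) ->
  hi (spow x 4) = hi (spow y 4) -> x <> y ->
  powers x `&` powers y = powers (hi (spow x 4)).
Proof.
move=> /has_type_ptype xP /has_type_ptype yP exy xy.
have sub z : powers z (hi (spow z 4)).
  by case: (hi_or (spow z 4)) => ->; rewrite ?spowM //; exact: powers_spow.
apply/seteqP; split=> [v [xv yv]|v uv]; last first.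
  by split; [apply: powers_trans uv | rewrite exy in uv; apply: powers_trans uv].
case: xv => n n0; rewrite (spow_reduce xP); have := reduce_bounds xP n0.
case: (reduce 2 3 n) => [|[|k]] // k3 e; subst v; first by case: xy; exact: type23_top.
have eqS a b : 0 < a -> 0 < b -> reduce 2 3 a == reduce 2 3 b -> spow x a = spow x b.
  by move=> a0 b0; rewrite -(spow_eq xP) // => /eqP.
case: (hi_or (spow x 4)) => ->; rewrite ?spowM //; case: k k3 {yv} => [|[|[|k]]] // _.
- by exists 2; rewrite // spowM //; apply: eqS.
- by exists 3; rewrite // spowM //; apply: eqS.
- exact: powers_refl.
- by exists 1; rewrite // spowM //; apply: eqS.
- by exists 3; rewrite // spowM //; apply: eqS.
- by exists 2; rewrite // spowM //; apply: eqS.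
Qed.

Hypothesis no_tops : ~ (exists a b c : S,
  [/\ a <> b, a <> c & b <> c] /\
  [/\ has_order a 4, has_order b 4 & has_order c 4] /\
  [/\ has_index a 2, has_index b 2 & has_index c 2] /\
  powers a `&` powers b `&` powers c #= `I_3).

(** The element [x] forces rank 2 on [y]. If [x] has rank 2 too, some [w] comes before it, and [w],
    [x], [y] contradict condition (ii). *)
Lemma rank_top_inj x y : ptype x = (2, 3) -> ptype y = (2, 3) ->
  hi (spow x 4) = hi (spow y 4) -> rank x = rank y -> h x < h y -> False.
Proof.
move=> tx ty exy rxy hxy.
have /asboolP : `[< exists w, [/\ ptype w = (2, 3), hi (spow w 4) = hi (spow x 4) & h w < h x] >].
  move: rxy; rewrite /rank tx ty; case: ifP => // _; case: ifP => // /negP[].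
  by apply/asboolP; exists x.
move=> [w [tw ewx hwx]]; apply: no_tops; exists w, x, y.
have neq a b : h a < h b -> a <> b by move=> /[swap] ->; rewrite ltnn.
have wy := neq _ _ (ltn_trans hwx hxy); have {}wx := neq _ _ hwx.
have {neq} xy := neq _ _ hxy.
have [wP xP yP] : [/\ has_type w 2 3, has_type x 2 3 & has_type y 2 3].
  by split; apply: has_type_ptype.
split=> //; split.
  by split; [exact: order_type wP | exact: order_type xP | exact: order_type yP].
split; first by split; [exact: index_type wP | exact: index_type xP | exact: index_type yP].
rewrite top_powers // ewx -(top_powers tx ty exy xy) -setIA [powers y `&` _]setIid top_powers //.
apply: (order_type (m := 1) (r := 3)); apply: has_type_ptype.
by case: (hi_or (spow x 4)) => ->; rewrite ?spowM // (ptype_pow tx).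
Qed.

(** As S may be uncountable, [h] is injective only on the powers of elements of [D]. Where [rep]
    fails to separate leaves, namely generators of one group of order 4 or members of a path through
    a group of order 3, [rank] does. *)
Lemma code_inj (D : set S) :
  (forall x y m n, D x -> D y -> 0 < m -> 0 < n ->
     h (spow x m) = h (spow y n) -> spow x m = spow y n) ->
  forall x y, D x -> D y -> code x = code y -> x = y.
Proof.
move=> hI x y Dx Dy; rewrite /code.
have hxy : h x = h y -> x = y by move=> e; exact: (hI x y 1 1).
case: (spow x 2 =P x) => x2; case: (spow y 2 =P y) => y2; [|by case: ifP|by case: ifP|].
  have idem z : spow z 2 = z -> spow z 12 = z.
    move=> z2; suff H n : spow z n.+1 = z by exact: (H 11).
    by elim: n => // n IH; rewrite spowS // IH.
  by case=> /(hI x y 12 12 Dx Dy isT isT); rewrite !idem.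
case: (centre x =P x) => cx; case: (centre y =P y) => cy // []; first by move=> _ /hxy.
move=> _ _ e; have := rank_lt3 x; have := rank_lt3 y => rx ry.
have [eh er] : h (rep x) = h (rep y) /\ rank x = rank y by lia.
have {eh} : rep x = rep y.
  have [m m0 em] := rep_pow x; have [n n0 en] := rep_pow y.
  by move: eh; rewrite em en; exact: hI.
move=> erep; have := congr1 ptype erep; rewrite !ptype_rep.
have rep_id z : ptype z != (1, 4) -> ptype z != (2, 3) -> rep z = z.
  have := ptype_small z; rewrite /rep !inE.
  by repeat match goal with |- is_true (_ || _) -> _ => case/orP end; move=> /eqP ->.
have [tx|tx] := eqVneq (ptype x) (2, 3); have [ty|ty] := eqVneq (ptype y) (2, 3).
- move=> _; have exy : hi (spow x 4) = hi (spow y 4).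
    by move: erep; rewrite /rep tx ty.
  case: (ltngtP (h x) (h y)) => [lt|gt|/hxy //]; exfalso.
    exact: (rank_top_inj tx ty).
  exact: (rank_top_inj ty tx).
- by move/esym=> ty'; move: er; rewrite /rank tx ty'; case: ifP.
- by move=> tx'; move: er; rewrite /rank ty tx'; case: ifP.
have [tx4|tx4] := eqVneq (ptype x) (1, 4) => txy; last first.
  by move: erep; rewrite !rep_id // -txy.
have ty4 := etrans (esym txy) tx4.
have pow9 z : ptype z = (1, 4) -> spow (spow z 3) 3 = z.
  move=> /has_type_ptype zP; rewrite spowM //; apply/eqP.
  by rewrite (spow_eq zP (i := 9) (j := 1)).
move: erep er; rewrite /rank /rep tx4 ty4.
case: eqP => [->|nx]; case: eqP => [->|ny] //= e0 _; move: e0.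
case: (lo3_or x) (lo3_or y) => [//|->] [//|->] e3.
by rewrite -(pow9 x) // e3 pow9.
Qed.

End Coding.

Theorem theorem3p16 (R : realType) (S : semigroupType)
    (index_order4 : forall a : S, has_order a 4 ->
       has_index a 1 \/ has_index a 2) :
  planar R (@enhanced_power_graph S) <->
    (forall a : S, powers a #<= `I_4) /\
    ~ (exists a b c : S,
         [/\ a <> b, a <> c & b <> c] /\
         [/\ has_order a 4, has_order b 4 & has_order c 4] /\
         [/\ has_index a 2, has_index b 2 & has_index c 2] /\
         powers a `&` powers b `&` powers c #= `I_3).
Proof.
split=> [planarS | [finS no_tops] X cX].
  by split; [exact: planar_order_le4 planarS | exact: planar_no_tops planarS].
(* [code] applies [h] also to the idempotent, the centre and the representative of an element, which
   are powers of it. *)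
pose Y := [set spow xn.1 xn.2 | xn in X `*` [set n | 0 < n]].
have /countable_injP[h hI] : countable Y.
  apply: card_le_trans (card_image_le _ _) _.
  by apply: countableX => //; exact: countableP.
have codeI : injective (fun x : X => code h (\val x)).
  move=> x y e; apply/val_inj.
  apply: (code_inj finS index_order4 no_tops (D := X) _ _ _ e);
    [|exact: set_valP|exact: set_valP].
  by move=> u v m n Xu Xv m0 n0; apply: hI; rewrite inE; [exists (u, m) | exists (v, n)].
apply: embeds_in_plane_sub (embeds_in_plane_inj codeI (fan_plane R)) => x y.
exact: code_adj.
Qed.
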